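(* Assume that the communication graph and its adjacency matrix satisfy: for some constant $0<\epsilon<1$, $a_{ij}>\epsilon$ whenever $(j,i)\in\mathcal E$, and $\sum_{i=1}^N a_{ij}=\sum_{j=1}^N a_{ij}=1$ for all $i,j$. Assume that there are constants $r_l,r_u>0$ with $r_l\mathbb B^d\subseteq\mathcal X\subseteq r_u\mathbb B^d$. Assume that every $f_t^i$ is convex and is Lipschitz continuous with constant $L_0>0$, i.e. $|f_t^i(x)-f_t^i(y)|\le L_0\|x-y\|$ for all $x,y\in\mathcal X+\delta\mathbb B^d$, for all $t$ and $i$. Run the algorithm $$x_{t+1}^i=\Pi_{\mathcal X}\Big[\sum_{j=1}^N a_{ij}\big(x_t^j-\eta\,\widetilde g_t^j(x_t^j)\big)\Big],\qquad i=1,\dots,N,\ t=0,1,\dots,T,$$ with $$\eta=\frac{1}{\sqrt{3\alpha}\,d\,L_0\,T^{2/3}},\qquad \delta=\frac{2}{T^{1/3}}.$$ Then the regret $$R_g^T=\mathbb E\Big[\sum_{t=1}^T\sum_{i=1}^N\big(f_t^i(x_t^i)-f_t^i(x^* )\big)\Big],\qquad x^*\in\arg\min_{x\in\mathcal X}\sum_{t=1}^T\sum_{i=1}^N f_t^i(x),$$ satisfies $$R_g^T\le\mathcal O\big(\max\{T^{2/3},\Theta_T^2\}\big)\qquad\text{as }T\to\infty,$$ i.e. there is a constant $C>0$ independent of $T$ such that $R_g^T\le C\max\{T^{2/3},\Theta_T^2\}$ for all sufficiently large $T$.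
   Context: There are $N$ agents communicating over an undirected graph $\mathcal G=(\mathcal V,\mathcal E,\mathcal A)$, $\mathcal V=\{1,\dots,N\}$, $\mathcal E\subset\mathcal V\times\mathcal V$, with adjacency matrix $\mathcal A=[a_{ij}]$, where $a_{ij}>0$ if $(i,j)\in\mathcal E$, $a_{ii}>0$ for all $i$, and $a_{ij}=0$ otherwise. The set $\mathcal X\subset\mathbb R^d$ is closed and convex, $\Pi_{\mathcal X}$ is Euclidean projection onto $\mathcal X$, $\mathbb B^d$ is the closed unit ball and $\mathbb S^d$ the unit sphere of $\mathbb R^d$, and $\|\cdot\|$ is the Euclidean norm. For each agent $i$ there is a sequence of local objective functions $f_t^i:\mathbb R^d\to\mathbb R$ indexed by time $t$. For $\delta>0$ the one-point residual feedback (ORF) estimator is $$\widetilde g_t^i(x_t^i)=\frac d\delta\big(f_t^i(x_t^i+\delta u_t^i)-f_{t-1}^i(x_{t-1}^i+\delta u_{t-1}^i)\big)u_t^i,$$ where the $u_t^i$ are independent random vectors uniformly distributed on $\mathbb S^d$. The initial points satisfy $x_0^i\in\mathcal X$. For $t=0$ the estimator uses initial data $f_{-1}^i$, $x_{-1}^i\in\mathcal X$, $u_{-1}^i$ of the same type (fixed independently of $T$). Enlarged set: $\mathcal X_\delta=\{x+\delta v: x\in\mathcal X,\ v\in\mathbb S^d\}$. Increasing rate: $\theta_{i,t}=\sup_{x\in\mathcal X_\delta}|f_t^i(x)-f_{t-1}^i(x)|$ for $t=1,\dots,T$. Accumulated increasing rate: $\Theta_T=\sum_{t=1}^T\sum_{i=1}^N\theta_{i,t}$.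 Constants: $\gamma=1-\frac{\epsilon}{4N^2}$ and $\alpha=2+\frac{60N^2}{1-\gamma^2}$. *)

(* Defs.v *)
From HB Require Import structures.
From mathcomp Require Import all_boot all_order all_algebra.
From mathcomp Require Import all_classical all_reals all_analysis.

Set Implicit Arguments.
Unset Strict Implicit.
Unset Printing Implicit Defensive.

Import Order.TTheory GRing.Theory Num.Theory.
Import numFieldNormedType.Exports.

Local Open Scope classical_set_scope.
Local Open Scope ring_scope.

(* R^d is ['rV[R]_d]. Its canonical norm is the sup norm, hence this definition;
   both norms induce the same topology, so [open] and [closed] are the
   library's. *)
Definition enorm (R : realType) (d : nat) (x : 'rV[R]_d) : R :=
  Num.sqrt (\sum_(k < d) x 0 k ^+ 2).

Definition eball (R : realType) (d : nat) : set 'rV[R]_d :=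
  [set v | enorm v <= 1].

Definition esphere (R : realType) (d : nat) : set 'rV[R]_d :=
  [set v | enorm v = 1].

Definition dilate (R : realType) (d : nat) (X : set 'rV[R]_d) (delta : R)
    (V : set 'rV[R]_d) : set 'rV[R]_d :=
  [set x + delta *: v | x in X & v in V].

(* For a nonempty closed convex [X] the minimizer exists and is unique, so the
   choice operator [get] returns the Euclidean projection of [y] onto [X]. *)
Definition eproj (R : realType) (d : nat) (X : set 'rV[R]_d) (y : 'rV[R]_d) :
    'rV[R]_d :=
  get [set p | X p /\ forall z, X z -> enorm (y - p) <= enorm (y - z)].

Definition lipschitz_in (R : realType) (d : nat) (L : R) (D : set 'rV[R]_d)
    (h : 'rV[R]_d -> R) : Prop :=
  forall x y, D x -> D y -> `|h x - h y| <= L * enorm (x - y).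

Definition is_argmin (T : Type) (R : realType) (X : set T) (h : T -> R)
    (x : T) : Prop :=
  X x /\ forall y, X y -> h x <= h y.

(* R^d with its Borel sigma-algebra. *)
Definition borel_rV (R : realType) (d : nat) :=
  g_sigma_algebraType (@open 'rV[R]_d).

(* The uniform distribution on the unit sphere: the probability measure carried
   by the sphere that is invariant under all orthogonal transformations. The
   full orthogonal group is needed for the case d = 1, where the sphere is
   {-1, 1}. *)
Definition uniform_on_sphere (R : realType) (d : nat)
    (mu : probability (borel_rV R d) R) : Prop :=
  mu (@esphere R d) = 1%E /\
  forall (Q : 'M[R]_d), Q *m Q^T = 1%:M ->
  forall B : set (borel_rV R d), measurable B ->
    mu [set v : 'rV[R]_d | B (v *m Q)] = mu B.

Definition mutually_independent (d1 d2 : measure_display)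
    (Om : measurableType d1) (S : measurableType d2) (R : realType)
    (P : probability Om R) (I : eqType) (U : I -> {RV P >-> S}) : Prop :=
  forall (s : seq I) (B : I -> set S), uniq s ->
    (forall k, measurable (B k)) ->
    P (\big[setI/setT]_(k <- s) (U k @^-1` B k)) =
    (\prod_(k <- s) P (U k @^-1` B k))%E.

(* [lag vm1 v t] is v_(t-1), with [vm1] in the role of v_(-1); as [t] ranges
   over [nat] it enumerates the whole sequence v_(-1), v_0, v_1, ... *)
Definition lag (A : Type) (vm1 : A) (v : nat -> A) (t : nat) : A :=
  if t is s.+1 then v s else vm1.

(* The arguments are f_t, f_(t-1), x_t, x_(t-1), u_t, u_(t-1). *)
Definition orf (R : realType) (d : nat) (delta : R) (f f' : 'rV[R]_d -> R)
    (x x' u u' : 'rV[R]_d) : 'rV[R]_d :=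
  (d%:R / delta * (f (x + delta *: u) - f' (x' + delta *: u'))) *: u.

Definition gammac (R : realType) (N : nat) (eps : R) : R :=
  1 - eps / (4 * N%:R ^+ 2).

Definition alphac (R : realType) (N : nat) (eps : R) : R :=
  2 + 60 * N%:R ^+ 2 / (1 - gammac N eps ^+ 2).

Definition etac (R : realType) (N d : nat) (eps L0 : R) (T : nat) : R :=
  (Num.sqrt (3 * alphac N eps) * d%:R * L0 * T%:R `^ (2 / 3))^-1.

Definition deltac (R : realType) (T : nat) : R := 2 / T%:R `^ (1 / 3).

(* [x t i w] is x_t^i at the sample point [w]; [um1] and [u] are the
   directions. *)
Definition orf_run (R : realType) (N d : nat) (Om : Type) (a : 'M[R]_N)
    (X : set 'rV[R]_d) (eta delta : R)
    (fm1 : 'I_N -> 'rV[R]_d -> R) (f : nat -> 'I_N -> 'rV[R]_d -> R)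
    (xm1 x0 : 'I_N -> 'rV[R]_d)
    (um1 : 'I_N -> Om -> 'rV[R]_d) (u : nat -> 'I_N -> Om -> 'rV[R]_d)
    (T : nat) (x : nat -> 'I_N -> Om -> 'rV[R]_d) : Prop :=
  let g t j w :=
    orf delta (f t j) (lag fm1 f t j)
        (x t j w) (lag (fun i _ => xm1 i) x t j w)
        (u t j w) (lag um1 u t j w) in
  (forall i w, x 0 i w = x0 i) /\
  (forall t i w, (t <= T)%N ->
     x t.+1 i w = eproj X (\sum_(j < N) a i j *: (x t j w - eta *: g t j w))).

Definition increasing_rate (R : realType) (d : nat) (X : set 'rV[R]_d)
    (delta : R) (f f' : 'rV[R]_d -> R) : R :=
  sup [set `|f x - f' x| | x in dilate X delta (@esphere R d)].

Definition acc_increasing_rate (R : realType) (N d : nat) (X : set 'rV[R]_d)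
    (delta : R) (f : nat -> 'I_N -> 'rV[R]_d -> R) (T : nat) : R :=
  \sum_(1 <= t < T.+1) \sum_(i < N)
    increasing_rate X delta (f t i) (f t.-1 i).

Definition regret (R : realType) (N d : nat) (disp : measure_display)
    (Om : measurableType disp) (P : probability Om R)
    (f : nat -> 'I_N -> 'rV[R]_d -> R)
    (x : nat -> 'I_N -> Om -> 'rV[R]_d) (xs : 'rV[R]_d) (T : nat) : \bar R :=
  'E_P[fun w => \sum_(1 <= t < T.+1) \sum_(i < N)
                  (f t i (x t i w) - f t i xs)].

(* Main.v *)
Require Import Defs.
From HB Require Import structures.
From mathcomp Require Import all_boot all_order all_algebra.
From mathcomp Require Import all_classical all_reals all_analysis.
From mathcomp Require Import measurable_realfun.
From mathcomp Require Import ring lra.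

Set Implicit Arguments.
Unset Strict Implicit.
Unset Printing Implicit Defensive.

Import Order.TTheory GRing.Theory Num.Theory.
Import numFieldNormedType.Exports.

Local Open Scope classical_set_scope.
Local Open Scope ring_scope.

(** Every agent is charged its own function at its own state, so the distances of
    all agents to the comparison point can be added up. Projection does not
    increase distances to points of [X], and averaging with doubly stochastic
    weights does not increase the sum of the squared distances. The usual
    telescoping argument then bounds the sum of the inner products of the
    estimates with [x_t - x^*] by [N ru^2 / eta] plus [eta] times the sum of the
    squared norms of the estimates, up to constant factors
    ([linearized_regret_le]).

    Averaging in fact decreases that sum by a variance, of which the positive
    self-weights retain a fixed share ([average_dissipation]). Telescoping again,
    now around the origin, shows that the states move little in total. A squared
    increment of the observed values is at most a constant times
    [theta^2 + L^2 |x_t - x_(t-1)|^2 + L^2 delta^2], and the movement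
    [x_t - x_(t-1)] is governed by the previous increment; once [T] is large this
    recursion closes and bounds the sum of the squared increments by a constant
    times [1 + T^(1/3) + Theta^2] ([sum_sqr_increment_le]). With
    [eta ~ T^(-2/3)] and [delta ~ T^(-1/3)], the factor [eta / delta^2] in front
    of that sum is constant and [1 / eta] is of order [T^(2/3)] ([regret_rate]).
    All this holds for every sample point.

    The expectation enters only to compare the inner products with the regret. For
    fixed [x] and [y] in [X] and a uniform direction [u],
    [(d / delta) E[f (x + delta u) <u, x - y>]] is at least
    [f x - f y - 2 delta L] ([estimator_subgradient]). Neither smoothing nor the
    divergence theorem is used: pairing [u] with its mirror image along [y - x]
    leaves a difference of [f] along a chord parallel to [y - x], whose slope is
    bounded by convexity, and [E <u, z>^2 = |z|^2 / d]. The residual value which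
    the estimator subtracts is multiplied by a vector of mean zero.

    The direction at time [t] is independent of the sigma-algebra generated by
    the earlier ones, on which the state and the residual value are measurable, so
    the past may be frozen by Fubini's theorem ([freeze_history],
    [expected_gap_le]). Finally, the directions lie on the sphere only almost
    surely, and off the sphere the functions are not controlled; precomposing
    everything with a measure-preserving map onto the good event ([retract])
    removes the exceptional null set. *)

(** * Euclidean geometry of row vectors *)

Section Euclidean.
Context {R : realType} {d : nat}.
Implicit Types (x y z : 'rV[R]_d) (c : R).

Definition dot x y : R := \sum_(k < d) x 0 k * y 0 k.

Lemma dotC x y : dot x y = dot y x.
Proof. by apply: eq_bigr => k _; rewrite mulrC. Qed.

Lemma dotDl x y z : dot (x + y) z = dot x z + dot y z.
Proof. by rewrite -big_split; apply: eq_bigr => k _ /=; rewrite mxE mulrDl. Qed.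

Lemma dotZl c x y : dot (c *: x) y = c * dot x y.
Proof. by rewrite mulr_sumr; apply: eq_bigr => k _ /=; rewrite mxE mulrA. Qed.

Lemma dotNl x y : dot (- x) y = - dot x y.
Proof. by rewrite -scaleN1r dotZl mulN1r. Qed.

Lemma dotBl x y z : dot (x - y) z = dot x z - dot y z.
Proof. by rewrite dotDl dotNl. Qed.

Lemma dotDr x y z : dot z (x + y) = dot z x + dot z y.
Proof. by rewrite dotC dotDl !(dotC z). Qed.

Lemma dotZr c x y : dot x (c *: y) = c * dot x y.
Proof. by rewrite dotC dotZl dotC. Qed.

Lemma dotNr x y : dot x (- y) = - dot x y.
Proof. by rewrite dotC dotNl dotC. Qed.

Lemma dotBr x y z : dot z (x - y) = dot z x - dot z y.
Proof. by rewrite dotC dotBl !(dotC z). Qed.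

Lemma dot0l x : dot 0 x = 0.
Proof. by rewrite -(scale0r x) dotZl mul0r. Qed.

Lemma dot_suml (I : Type) (r : seq I) (F : I -> 'rV[R]_d) x :
  dot (\sum_(i <- r) F i) x = \sum_(i <- r) dot (F i) x.
Proof.
elim: r => [|i r IH]; first by rewrite !big_nil dot0l.
by rewrite !big_cons dotDl IH.
Qed.

Definition dotE := (dotDl, dotDr, dotBl, dotBr, dotNl, dotNr, dotZl, dotZr).

Lemma dot_ge0 x : 0 <= dot x x.
Proof. by apply: sumr_ge0 => k _; rewrite -expr2 sqr_ge0. Qed.

Lemma sqr_enorm x : enorm x ^+ 2 = dot x x.
Proof. by rewrite sqr_sqrtr; [exact: eq_bigr | exact: dot_ge0]. Qed.

Lemma enorm_ge0 x : 0 <= enorm x.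
Proof. exact: sqrtr_ge0. Qed.

Lemma sqr_coord_le x k : x 0 k ^+ 2 <= dot x x.
Proof.
rewrite [dot _ _](bigD1 k)//= -expr2 lerDl.
by apply: sumr_ge0 => j _; rewrite -expr2 sqr_ge0.
Qed.

Lemma coord_le_enorm x k : `|x 0 k| <= enorm x.
Proof.
rewrite -(@ler_pXn2r _ 2) ?nnegrE ?enorm_ge0//.
by rewrite sqr_enorm -normrX ger0_norm ?sqr_ge0// sqr_coord_le.
Qed.

Lemma dotxx_eq0 x : dot x x = 0 -> x = 0.
Proof.
move=> x0; apply/rowP => k; rewrite mxE; apply/eqP.
by rewrite -sqrf_eq0 eq_le sqr_ge0 andbT -x0 sqr_coord_le.
Qed.

Lemma enorm_eq1 x : enorm x = 1 -> dot x x = 1.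
Proof. by move=> x1; rewrite -sqr_enorm x1 expr1n. Qed.

Lemma enorm_leP x c : 0 <= c -> (enorm x <= c) = (dot x x <= c ^+ 2).
Proof. by move=> c0; rewrite -sqr_enorm ler_pXn2r// nnegrE enorm_ge0. Qed.

Lemma enormZ c x : enorm (c *: x) = `|c| * enorm x.
Proof.
apply/eqP; rewrite -(@eqrXn2 _ 2) ?enorm_ge0 ?mulr_ge0 ?enorm_ge0//.
by rewrite exprMn !sqr_enorm dotZl dotZr mulrA -expr2 real_normK ?num_real.
Qed.

Lemma enormN x : enorm (- x) = enorm x.
Proof. by rewrite -scaleN1r enormZ normrN1 mul1r. Qed.

Lemma sqr_dot_le x y : dot x y ^+ 2 <= dot x x * dot y y.
Proof.
have [y0|y0] := eqVneq (dot y y) 0.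
  by rewrite (dotxx_eq0 y0) dotC dot0l expr0n mulr_ge0 ?dot_ge0.
have yp : 0 < dot y y by rewrite lt_def y0 dot_ge0.
have := dot_ge0 (dot y y *: x - dot x y *: y).
rewrite !dotE (dotC y x) => h.
have : 0 <= dot y y * (dot x x * dot y y - dot x y ^+ 2).
  by apply: le_trans h _; rewrite le_eqVlt; apply/orP; left; apply/eqP; ring.
by rewrite pmulr_rge0// subr_ge0.
Qed.

Lemma normr_dot_le x y : `|dot x y| <= enorm x * enorm y.
Proof.
rewrite -(@ler_pXn2r _ 2) ?nnegrE ?mulr_ge0 ?enorm_ge0//.
by rewrite exprMn !sqr_enorm real_normK ?num_real// sqr_dot_le.
Qed.

Lemma dot_le_enorm x y : dot x y <= enorm x * enorm y.
Proof. exact: le_trans (ler_norm _) (normr_dot_le x y). Qed.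

Lemma ler_enormD x y : enorm (x + y) <= enorm x + enorm y.
Proof.
rewrite enorm_leP ?addr_ge0 ?enorm_ge0//.
rewrite !dotE (dotC y x) -!sqr_enorm; have := dot_le_enorm x y; nra.
Qed.

Lemma enorm_le_sum x : enorm x <= \sum_(k < d) `|x 0 k|.
Proof.
rewrite enorm_leP ?sumr_ge0// expr2 mulr_sumr; apply: ler_sum => k _.
apply: le_trans (ler_norm _) _; rewrite normrM ler_wpM2r//.
by rewrite (bigD1 k)//= lerDl sumr_ge0.
Qed.

Lemma dot_sqr_normD x y : dot (x + y) (x + y) <= 2 * dot x x + 2 * dot y y.
Proof.
have := dot_ge0 (x - y); rewrite !dotE (dotC y x); lra.
Qed.

Lemma conv_mem (X : set 'rV[R]_d) (t : R) x y :
  convex_set (X : set (convex_lmodType 'rV[R]_d)) ->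
  0 <= t <= 1 -> X x -> X y -> X (t *: x + (1 - t) *: y).
Proof.
move=> cX /andP[t0 t1] Xx Xy.
exact: (set_mem (cX x y (Itv01 t0 t1) (mem_set Xx) (mem_set Xy))).
Qed.

Lemma conv_ler (h : 'rV[R]_d -> R) (t : R) x y :
  convex_function ([set: 'rV[R]_d] : set (convex_lmodType 'rV[R]_d)) h ->
  0 <= t <= 1 -> h (t *: x + (1 - t) *: y) <= t * h x + (1 - t) * h y.
Proof.
move=> ch /andP[t0 t1].
exact: (ch (Itv01 t0 t1) x y (mem_set I) (mem_set I)).
Qed.

End Euclidean.

(** * Euclidean projection onto a closed, bounded, convex set *)

Lemma continuous_bigsum (R : realType) (V : topologicalType) (I : Type)
    (r : seq I) (F : I -> V -> R) :
  (forall i, continuous (F i)) -> continuous (fun z => \sum_(i <- r) F i z).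
Proof.
move=> Fc; elim: r => [|i r IH].
  have -> : (fun z => \sum_(i <- [::]) F i z) = cst 0.
    by apply/funext => z; rewrite big_nil.
  exact: cst_continuous.
have -> : (fun z => \sum_(j <- i :: r) F j z) =
    (fun z => F i z + \sum_(j <- r) F j z).
  by apply/funext => z; rewrite big_cons.
by move=> z; apply: continuousD; [exact: Fc | exact: IH].
Qed.

Section Projection.
Context {R : realType} {d : nat}.
Variables (X : set 'rV[R]_d) (ru : R).
Hypotheses (X_closed : closed X)
  (X_convex : convex_set (X : set (convex_lmodType 'rV[R]_d)))
  (X_bounded : forall z, X z -> enorm z <= ru) (X0 : X 0).
Implicit Types (x y z p : 'rV[R]_d).

Lemma eproj_exists y :
  exists p, X p /\ forall z, X z -> enorm (y - p) <= enorm (y - z).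
Proof.
have Xcpt : compact X.
  apply: bounded_closed_compact => //; exists ru; split; first exact: num_real.
  move=> M ruM z /X_bounded zru.
  rewrite /Num.norm /= mx_normrE; apply/bigmax_leP; split.
    by apply: le_trans (ltW ruM); apply: le_trans zru; exact: enorm_ge0.
  move=> [i k] _ /=; rewrite ord1; apply: le_trans (coord_le_enorm z k) _.
  exact: le_trans zru (ltW ruM).
have hc : continuous (fun z : 'rV[R]_d => dot (y - z) (y - z)).
  apply: continuous_bigsum => k.
  have hk : continuous (fun z : 'rV[R]_d => y 0 k - z 0 k).
    move=> z; apply: continuousB; first exact: cst_continuous.
    exact: coord_continuous.
  have -> : (fun z : 'rV[R]_d => (y - z) 0 k * (y - z) 0 k) =
      (fun z => (y 0 k - z 0 k) * (y 0 k - z 0 k)).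
    by apply/funext => z; rewrite !mxE.
  move=> z; apply: (cvgM (hk z) (hk z)).
have [|p /set_mem Xp hp] := @EVT_min_rV _ _ _ X _ Xcpt (continuous_subspaceT hc).
  by exists 0.
exists p; split => // z Xz.
by rewrite enorm_leP ?enorm_ge0// sqr_enorm; apply: hp; rewrite inE.
Qed.

Lemma eproj_min y : X (eproj X y) /\
  forall z, X z -> enorm (y - eproj X y) <= enorm (y - z).
Proof. by have := getPex (eproj_exists y). Qed.

Lemma eproj_mem y : X (eproj X y). Proof. by have [] := eproj_min y. Qed.

(** Moving from the nearest point [p] a small step [t] towards [z] stays in
    [X], so the derivative at [t = 0] of the squared distance to [y] is
    nonnegative. *)
Lemma eproj_obtuse y z : X z -> dot (y - eproj X y) (z - eproj X y) <= 0.
Proof.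
set p := eproj X y => Xz; rewrite leNgt; apply/negP => s_gt0.
have Xp : X p by exact: eproj_mem.
set s := dot _ _ in s_gt0; set D := dot (z - p) (z - p).
have D0 : 0 <= D by exact: dot_ge0.
have le2 t : 0 <= t <= 1 -> 2 * t * s <= t ^+ 2 * D.
  move=> t01; have Xt := conv_mem X_convex t01 Xz Xp.
  have := (eproj_min y).2 _ Xt; rewrite enorm_leP ?enorm_ge0// sqr_enorm -/p.
  have -> : y - (t *: z + (1 - t) *: p) = (y - p) - t *: (z - p).
    by apply/rowP => k; rewrite !mxE; ring.
  rewrite (dotBl (y - p)) !(dotBr _ (t *: _)) !dotZr !dotZl.
  rewrite (dotC (z - p) (y - p)) -/s -/D => h; nra.
(* This [t] stays in [0, 1] also when [D < s], and contradicts [le2]. *)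
pose t := s / (s + D).
have sD : 0 < s + D by rewrite ltr_wpDr.
have t_gt0 : 0 < t by rewrite divr_gt0.
have tE : t * (s + D) = s by rewrite /t divfK ?gt_eqF.
have t01 : 0 <= t <= 1.
  by rewrite (ltW t_gt0) /= ler_pdivrMr// mul1r lerDl.
have h : 2 * s <= t * D.
  rewrite -(ler_pM2l t_gt0).
  have -> : t * (2 * s) = 2 * t * s by ring.
  have -> : t * (t * D) = t ^+ 2 * D by ring.
  exact: le2.
have ts : 0 < t * s by rewrite mulr_gt0.
by move: tE h ts; rewrite mulrDr; lra.
Qed.

Lemma eproj_nonexpansive x y :
  enorm (eproj X x - eproj X y) <= enorm (x - y).
Proof.
set p := eproj X x; set q := eproj X y.
have h1 : dot (x - p) (q - p) <= 0 by apply/eproj_obtuse/eproj_mem.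
have h2 : dot (y - q) (p - q) <= 0 by apply/eproj_obtuse/eproj_mem.
have h : dot (p - q) (p - q) <= dot (x - y) (p - q).
  move: h1 h2; rewrite !dotE !(dotC q) !(dotC y); lra.
have [->|pq] := eqVneq (enorm (p - q)) 0; first exact: enorm_ge0.
have pq_gt0 : 0 < enorm (p - q) by rewrite lt_def pq enorm_ge0.
rewrite -(ler_pM2r pq_gt0) -expr2 sqr_enorm.
exact: le_trans h (dot_le_enorm _ _).
Qed.

Lemma eproj_id z : X z -> eproj X z = z.
Proof.
move=> Xz; have := (eproj_min z).2 _ Xz.
rewrite subrr enorm_leP ?enorm_ge0// sqr_enorm dot0l => h.
apply/esym/subr0_eq/dotxx_eq0/eqP; by rewrite eq_le h dot_ge0.
Qed.

Lemma eproj_closer y z : X z -> enorm (eproj X y - z) <= enorm (y - z).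
Proof. by move=> Xz; rewrite -{1}(eproj_id Xz) eproj_nonexpansive. Qed.

End Projection.

(** * Averaging with doubly stochastic weights *)

Section Averaging.
Context {R : realType} {N d : nat}.
Variables (a : 'M[R]_N) (c : R).
Hypotheses (a_ge0 : forall i j, 0 <= a i j)
  (a_diag : forall i, c <= a i i)
  (a_col : forall j, \sum_(i < N) a i j = 1)
  (a_row : forall i, \sum_(j < N) a i j = 1).
Implicit Types (y : 'I_N -> 'rV[R]_d) (z : 'rV[R]_d).

Definition average y (i : 'I_N) := \sum_(j < N) a i j *: y j.

(** The mean squared distance to [z] exceeds the squared distance from [z] to
    the mean by the variance; the diagonal term of the variance is kept. *)
Lemma average_dissipation1 y z i :
  dot (average y i - z) (average y i - z)
    + c * dot (average y i - y i) (average y i - y i)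
  <= \sum_(j < N) a i j * dot (y j - z) (y j - z).
Proof.
set m := average y i.
have e j : a i j * dot (y j - z) (y j - z) =
    a i j * dot (m - y j) (m - y j) + a i j * dot (m - z) (m - z)
    + 2 * dot (a i j *: (y j - m)) (m - z).
  have -> : y j - z = (m - z) - (m - y j) by apply/rowP => k; rewrite !mxE; ring.
  have -> : a i j *: (y j - m) = (- a i j) *: (m - y j).
    by apply/rowP => k; rewrite !mxE; ring.
  rewrite (dotBl (m - z)) !(dotBr _ (m - y j)) dotZl (dotC (m - z) (m - y j)).
  by ring.
rewrite (eq_bigr _ (fun j _ => e j)) big_split /= big_split /=.
rewrite -mulr_suml a_row mul1r -mulr_sumr -dot_suml.
have -> : \sum_j a i j *: (y j - m) = 0.
  under eq_bigr do rewrite scalerBr.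
  by rewrite sumrB -scaler_suml a_row scale1r subrr.
rewrite dot0l mulr0 addr0 [leLHS]addrC lerD2r (bigD1 i)//=.
rewrite -[leLHS]addr0 lerD ?ler_wpM2r ?dot_ge0//.
by apply: sumr_ge0 => j _; rewrite mulr_ge0 ?dot_ge0.
Qed.

Lemma average_dissipation y z :
  \sum_(i < N) dot (average y i - z) (average y i - z)
    + c * \sum_(i < N) dot (average y i - y i) (average y i - y i)
  <= \sum_(j < N) dot (y j - z) (y j - z).
Proof.
rewrite mulr_sumr -big_split /=.
apply: le_trans (ler_sum _ (fun i _ => average_dissipation1 y z i)) _.
rewrite exchange_big /=; apply: ler_sum => j _.
by rewrite -mulr_suml a_col mul1r.
Qed.

End Averaging.

(** * Energy estimates along a trajectory *)

Lemma sum_sqr_le (R : realType) (I : Type) (r : seq I) (F : I -> R) :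
  (forall i, 0 <= F i) ->
  \sum_(i <- r) F i ^+ 2 <= (\sum_(i <- r) F i) ^+ 2.
Proof.
move=> F0; elim: r => [|i r IH]; first by rewrite !big_nil expr0n.
rewrite !big_cons sqrrD.
have : 0 <= F i * \sum_(j <- r) F j by rewrite mulr_ge0// sumr_ge0.
by move: IH; lra.
Qed.

Lemma absorb_arith (R : realType) (S K B0 B1 B2 B3 p q r v : R) :
  S <= K + B3 + B2 + 3 * p -> 6 * q <= B0 + 1 / 4 * S + B1 + v ->
  p <= 2 * q + 2 * r -> v + 6 * r <= 1 / 4 * S ->
  S <= 2 * (K + B3 + B2 + B0 + B1).
Proof. lra. Qed.

Section Trajectory.
Context {R : realType} {N d : nat}.
Variables (a : 'M[R]_N) (c : R).
Hypotheses (c_gt0 : 0 < c) (a_ge0 : forall i j, 0 <= a i j)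
  (a_diag : forall i, c <= a i i)
  (a_col : forall j, \sum_(i < N) a i j = 1)
  (a_row : forall i, \sum_(j < N) a i j = 1).
Variables (X : set 'rV[R]_d) (ru : R).
Hypotheses (X_closed : closed X)
  (X_convex : convex_set (X : set (convex_lmodType 'rV[R]_d)))
  (X_bounded : forall z, X z -> enorm z <= ru) (X0 : X 0) (ru_ge0 : 0 <= ru).
Variables (T : nat) (eta : R) (x g : nat -> 'I_N -> 'rV[R]_d).
Hypotheses (eta_ge0 : 0 <= eta) (x0_X : forall i, X (x 0 i))
  (xS : forall t i, (t <= T)%N ->
     x t.+1 i = eproj X (\sum_(j < N) a i j *: (x t j - eta *: g t j))).

Let y t i := x t i - eta *: g t i.
Let W t := \sum_(i < N) dot (average a (y t) i - y t i)
                            (average a (y t) i - y t i).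
Let G t z := \sum_(i < N) dot (g t i) (x t i - z).
Let Q t := \sum_(i < N) dot (g t i) (g t i).
Let V t z := \sum_(i < N) dot (x t i - z) (x t i - z).

Lemma trajectory_mem t i : (t <= T.+1)%N -> X (x t i).
Proof.
case: t => [|t] tT; first exact: x0_X.
by rewrite xS//; exact: (eproj_mem X_closed X_bounded X0).
Qed.

Let one_step t z : X z -> (t <= T)%N ->
  V t.+1 z + (c * W t + 2 * eta * G t z) <= V t z + eta ^+ 2 * Q t.
Proof.
move=> Xz tT.
have h1 : V t.+1 z <= \sum_(i < N) dot (average a (y t) i - z)
                                       (average a (y t) i - z).
  apply: ler_sum => i _; rewrite xS// -/(average a (y t) i).
  have := eproj_closer X_closed X_convex X_bounded X0 (average a (y t) i) Xz.
  by rewrite enorm_leP ?enorm_ge0// sqr_enorm.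
have h2 := average_dissipation a_ge0 a_diag a_col a_row (y t) z.
have h3 : \sum_(j < N) dot (y t j - z) (y t j - z) =
    V t z + eta ^+ 2 * Q t - 2 * eta * G t z.
  rewrite /V /Q /G !mulr_sumr -big_split /= -sumrB; apply: eq_bigr => j _.
  have -> : y t j - z = (x t j - z) - eta *: g t j.
    by rewrite /y; apply/rowP => k; rewrite !mxE; ring.
  rewrite (dotBl (x t j - z)) !(dotBr _ (eta *: _)) !dotZr !dotZl.
  rewrite (dotC (x t j - z) (g t j)); ring.
move: h1 h2; rewrite h3 -/(W t); lra.
Qed.

(** Telescoping the one-step estimate. The dissipation [W], which comes from the
    self-weights alone, controls how far the averaging step moves the agents. *)
Lemma energy_balance m n z : X z -> (m <= n <= T.+1)%N ->
  V n z + \sum_(m <= t < n) (c * W t + 2 * eta * G t z)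
    <= V m z + eta ^+ 2 * \sum_(m <= t < n) Q t.
Proof.
move=> Xz /andP[]; elim: n => [|n IH] mn nT.
  by move: mn; rewrite leqn0 => /eqP ->; rewrite !big_geq// mulr0 !addr0.
move: mn; rewrite leq_eqVlt => /orP[/eqP ->|mn].
  by rewrite !big_geq// mulr0 !addr0.
rewrite ltnS in mn; rewrite !big_nat_recr//=.
have := one_step Xz nT; have := IH mn (ltnW nT); rewrite mulrDr; lra.
Qed.

Let V_le t z : X z -> (t <= T.+1)%N -> V t z <= N%:R * (4 * ru ^+ 2).
Proof.
move=> Xz tT; rewrite mulr_natl -[X in _ *+ X]card_ord -sumr_const.
apply: ler_sum => i _.
have h v : X v -> dot v v <= ru ^+ 2.
  by move=> /X_bounded; rewrite enorm_leP.
have := dot_sqr_normD (x t i) (- z); rewrite dotNl dotNr opprK.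
have := h _ Xz; have := h _ (trajectory_mem i tT); lra.
Qed.

Let W_ge0 t : 0 <= W t.
Proof. by apply: sumr_ge0 => i _; exact: dot_ge0. Qed.

Let V_ge0 t z : 0 <= V t z.
Proof. by apply: sumr_ge0 => i _; exact: dot_ge0. Qed.

Lemma linearized_regret_le z : X z ->
  2 * eta * \sum_(1 <= t < T.+1) G t z
    <= N%:R * (4 * ru ^+ 2) + eta ^+ 2 * \sum_(1 <= t < T.+1) Q t.
Proof.
move=> Xz; have h1T : (1 <= T.+1 <= T.+1)%N by rewrite leqnn.
have := energy_balance Xz h1T; rewrite big_split /= -mulr_sumr.
rewrite -mulr_sumr.
have := V_ge0 T.+1 z; have := V_le Xz (leq_trans (isT : (1 <= 1)%N) (ltn0Sn T)).
have : 0 <= c * \sum_(1 <= t < T.+1) W t.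
  by rewrite mulr_ge0 ?(ltW c_gt0)// sumr_ge0.
lra.
Qed.

Let sum_W_le : c * \sum_(0 <= t < T.+1) W t <=
  N%:R * ru ^+ 2 +
  \sum_(0 <= t < T.+1) \sum_(i < N) (2 * ru) * (eta * enorm (g t i)) +
  eta ^+ 2 * \sum_(0 <= t < T.+1) Q t.
Proof.
have := energy_balance X0 (leqnn T.+1 : (0 <= T.+1 <= T.+1)%N).
rewrite big_split /= -mulr_sumr.
have V0 : V 0 0 <= N%:R * ru ^+ 2.
  rewrite mulr_natl -[X in _ *+ X]card_ord -sumr_const.
  by apply: ler_sum => i _; rewrite subr0 -enorm_leP// X_bounded.
have hG : - \sum_(0 <= t < T.+1) 2 * eta * G t 0 <=
    \sum_(0 <= t < T.+1) \sum_(i < N) (2 * ru) * (eta * enorm (g t i)).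
  rewrite -sumrN; apply: ler_sum_nat => t /andP[_ tT].
  rewrite /G mulr_sumr -sumrN; apply: ler_sum => i _; rewrite subr0.
  have := normr_dot_le (g t i) (x t i).
  have := X_bounded (trajectory_mem i (ltnW tT)).
  have := enorm_ge0 (g t i); have := ler_norm (- dot (g t i) (x t i)).
  rewrite normrN => h1 h2 h3 h4.
  have h5 : - dot (g t i) (x t i) <= ru * enorm (g t i).
    by apply: le_trans h1 (le_trans h4 _); rewrite mulrC ler_wpM2r.
  have := ler_wpM2l eta_ge0 h5; lra.
have := V_ge0 T.+1 0; move: V0 hG; lra.
Qed.

Let drift_le :
  \sum_(0 <= t < T.+1) \sum_(i < N) dot (x t.+1 i - x t i) (x t.+1 i - x t i)
  <= 2 * \sum_(0 <= t < T.+1) W t + 2 * (eta ^+ 2 * \sum_(0 <= t < T.+1) Q t).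
Proof.
rewrite mulrA !mulr_sumr -big_split /=; apply: ler_sum_nat => t /andP[_ tT].
rewrite /W /Q !mulr_sumr -big_split /=; apply: ler_sum => i _.
have h : dot (x t.+1 i - x t i) (x t.+1 i - x t i) <=
    dot (average a (y t) i - x t i) (average a (y t) i - x t i).
  rewrite xS// -/(average a (y t) i) -(sqr_enorm (average _ _ _ - _)).
  rewrite -enorm_leP ?enorm_ge0//.
  exact: (eproj_closer X_closed X_convex X_bounded X0 _
            (trajectory_mem i (ltnW tT))).
apply: le_trans h _.
have -> : average a (y t) i - x t i =
    (average a (y t) i - y t i) + (- eta) *: g t i.
  by rewrite {3}/y; apply/rowP => k; rewrite !mxE; ring.
apply: le_trans (dot_sqr_normD _ _) _.
by rewrite dotZl dotZr le_eqVlt; apply/orP; left; apply/eqP; ring.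
Qed.

Variables (L delta rho K0 : R) (D theta : nat -> 'I_N -> R).
Hypotheses (L_gt0 : 0 < L)
  (D0_le : \sum_(i < N) D 0 i ^+ 2 <= K0)
  (theta_ge0 : forall t i, 0 <= theta t i)
  (D_le : forall t i, (t < T)%N ->
     D t.+1 i ^+ 2 <= 3 * theta t.+1 i ^+ 2
       + 3 * L ^+ 2 * dot (x t.+1 i - x t i) (x t.+1 i - x t i)
       + 12 * L ^+ 2 * delta ^+ 2)
  (gE : forall t i, eta * enorm (g t i) = rho * `|D t i|)
  (rho_small : rho ^+ 2 * (6 * L ^+ 2 / c + 6 * L ^+ 2) <= 1 / 4).

(** The increments [D] enter their own bound twice: quadratically with the
    small factor [rho ^+ 2], and linearly through the dissipation; the linear
    occurrence is absorbed by the inequality between arithmetic and geometric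
    means, with [tau] chosen to cost a quarter of the left-hand side. *)
Lemma sum_sqr_increment_le :
  \sum_(0 <= t < T.+1) \sum_(i < N) D t i ^+ 2 <=
  2 * (K0 + 3 * (\sum_(1 <= t < T.+1) \sum_(i < N) theta t i) ^+ 2
       + 12 * L ^+ 2 * delta ^+ 2 * (T%:R * N%:R)
       + 6 * L ^+ 2 / c * (N%:R * ru ^+ 2)
       + 144 * L ^+ 4 / c ^+ 2 * ru ^+ 2 * rho ^+ 2 * (T.+1%:R * N%:R)).
Proof.
set S := (X in X <= _).
have etaQ : eta ^+ 2 * \sum_(0 <= t < T.+1) Q t = rho ^+ 2 * S.
  rewrite !mulr_sumr; apply: eq_bigr => t _; rewrite !mulr_sumr.
  apply: eq_bigr => i _; rewrite -sqr_enorm -exprMn gE exprMn.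
  by rewrite real_normK ?num_real.
(* The coefficient [6 * L ^+ 2 / c] of the linear term makes [1 / 4] of [tau]. *)
pose tau := c / (24 * L ^+ 2).
have L2 : 0 < L ^+ 2 by rewrite exprn_gt0.
have tau_gt0 : 0 < tau by rewrite divr_gt0// mulr_gt0.
have linear : \sum_(0 <= t < T.+1) \sum_(i < N) (2 * ru) * (eta * enorm (g t i))
    <= tau * S + ru ^+ 2 * rho ^+ 2 / tau * (T.+1%:R * N%:R).
  have -> : T.+1%:R * N%:R = \sum_(0 <= t < T.+1) \sum_(i < N) (1 : R).
    rewrite sumr_const card_ord sumr_const_nat subn0 -mulrnA -natrM.
    by rewrite mulnC.
  rewrite !mulr_sumr -big_split /=; apply: ler_sum => t _.
  rewrite !mulr_sumr -big_split /=; apply: ler_sum => i _.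
  rewrite gE mulr1.
  have h := sqr_ge0 (tau * `|D t i| - ru * rho).
  rewrite -subr_ge0.
  have -> : tau * D t i ^+ 2 + ru ^+ 2 * rho ^+ 2 / tau - 2 * ru * (rho * `|D t i|)
      = (tau * `|D t i| - ru * rho) ^+ 2 / tau.
    by rewrite -(real_normK (num_real (D t i))); field; rewrite gt_eqF.
  by rewrite divr_ge0// ltW.
have := sum_W_le; rewrite etaQ => hW.
have := drift_le; rewrite etaQ => hD.
have hS : S <= K0 + 3 * (\sum_(1 <= t < T.+1) \sum_(i < N) theta t i) ^+ 2
     + 12 * L ^+ 2 * delta ^+ 2 * (T%:R * N%:R)
     + 3 * L ^+ 2 * \sum_(0 <= t < T.+1) \sum_(i < N)
         dot (x t.+1 i - x t i) (x t.+1 i - x t i).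
  have hth : \sum_(0 <= t < T) \sum_(i < N) theta t.+1 i ^+ 2 <=
      (\sum_(1 <= t < T.+1) \sum_(i < N) theta t i) ^+ 2.
    rewrite big_add1 /=; apply: le_trans (sum_sqr_le _ _); last first.
      by move=> t; exact: sumr_ge0.
    by apply: ler_sum => t _; exact: sum_sqr_le.
  have hdr : \sum_(0 <= t < T) \sum_(i < N)
        dot (x t.+1 i - x t i) (x t.+1 i - x t i) <=
      \sum_(0 <= t < T.+1) \sum_(i < N)
        dot (x t.+1 i - x t i) (x t.+1 i - x t i).
    rewrite [leRHS]big_nat_recr//= lerDl.
    by apply: sumr_ge0 => i _; exact: dot_ge0.
  have hD' : \sum_(0 <= t < T) \sum_(i < N) D t.+1 i ^+ 2 <=
      3 * \sum_(0 <= t < T) \sum_(i < N) theta t.+1 i ^+ 2 +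
      3 * L ^+ 2 * \sum_(0 <= t < T) \sum_(i < N)
        dot (x t.+1 i - x t i) (x t.+1 i - x t i) +
      12 * L ^+ 2 * delta ^+ 2 * (T%:R * N%:R).
    have -> : T%:R * N%:R = \sum_(0 <= t < T) \sum_(i < N) (1 : R).
      rewrite sumr_const card_ord sumr_const_nat subn0 -mulrnA -natrM.
      by rewrite mulnC.
    rewrite !mulr_sumr -!big_split /=; apply: ler_sum_nat => t /andP[_ tT].
    rewrite !mulr_sumr -!big_split /=; apply: ler_sum => i _.
    by rewrite mulr1; exact: D_le.
  rewrite /S big_nat_recl//.
  have := ler_wpM2l (ltW (mulr_gt0 (ltr0n _ 3) L2)) hdr.
  move: D0_le hth hD'; lra.
set U := \sum_(0 <= t < T.+1) W t in hW hD.
set Dr := \sum_(0 <= t < T.+1) \sum_(i < N) dot _ _ in hD hS.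
have hU : 6 * L ^+ 2 * U <= 6 * L ^+ 2 / c * (N%:R * ru ^+ 2)
    + 1 / 4 * S + 144 * L ^+ 4 / c ^+ 2 * ru ^+ 2 * rho ^+ 2 * (T.+1%:R * N%:R)
    + 6 * L ^+ 2 / c * rho ^+ 2 * S.
  have c6 : 0 <= 6 * L ^+ 2 / c by rewrite divr_ge0 ?(ltW c_gt0)// mulr_ge0// ltW.
  have := ler_wpM2l c6 (le_trans hW (lerD (lerD (lexx _) linear) (lexx _))).
  have -> : 6 * L ^+ 2 / c * (c * U) = 6 * L ^+ 2 * U.
    by field; rewrite gt_eqF.
  move=> h; apply: le_trans h _; rewrite le_eqVlt; apply/orP; left; apply/eqP.
  by rewrite /tau; field; rewrite !gt_eqF.
have S0 : 0 <= S by apply: sumr_ge0 => t _; apply: sumr_ge0 => i _; exact: sqr_ge0.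
have hr := ler_wpM2r S0 rho_small.
have hD2 : L ^+ 2 * Dr <= 2 * (L ^+ 2 * U) + 2 * (L ^+ 2 * (rho ^+ 2 * S)).
  by apply: le_trans (ler_wpM2l (ltW L2) hD) _; rewrite le_eqVlt;
     apply/orP; left; apply/eqP; ring.
have hr2 : 6 * L ^+ 2 / c * rho ^+ 2 * S + 6 * (L ^+ 2 * (rho ^+ 2 * S)) <= 1 / 4 * S.
  by apply: le_trans hr; rewrite le_eqVlt; apply/orP; left; apply/eqP; ring.
move: hS hU hD2 hr2; rewrite -!(mulrA _ (L ^+ 2) Dr) -!(mulrA _ (L ^+ 2) U).
set p := L ^+ 2 * Dr; set q := L ^+ 2 * U; set r := L ^+ 2 * (rho ^+ 2 * S).
set v := 6 * L ^+ 2 / c * rho ^+ 2 * S; set B0 := 6 * L ^+ 2 / c * (N%:R * _).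
set B1 := 144 * _ / _ * _ * _ * _; set B2 := 12 * _ * _ * _; set B3 := 3 * (_ ^+ 2).
exact: absorb_arith.
Qed.

End Trajectory.

(** * Measurability of vector-valued maps *)

Section VectorMeasurability.
Context {R : realType} {d : nat}.

Definition coord_measurable {disp} {M : measurableType disp}
    (F : M -> 'rV[R]_d) :=
  forall k, measurable_fun [set: M] (fun w => F w 0 k).

Section Maps.
Context {disp : measure_display} {M : measurableType disp}.
Implicit Types (F G : M -> 'rV[R]_d) (D A : set 'rV[R]_d).

(** A relatively open set is a countable union of rational boxes. *)
Lemma measurable_preimage_relopen F D A :
  coord_measurable F -> (forall w, D (F w)) ->
  (forall v, A v -> D v -> exists2 e : R, 0 < e &
     forall v', D v' -> (forall k, `|v 0 k - v' 0 k| < e) -> A v') ->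
  measurable (F @^-1` A).
Proof.
move=> mF DF Aopen.
pose box (qr : {ffun 'I_d -> rat} * rat) : set 'rV[R]_d :=
  [set v | forall k, `|ratr (qr.1 k) - v 0 k| < ratr qr.2].
pose good qr := forall v, D v -> box qr v -> A v.
have -> : F @^-1` A =
    \bigcup_qr (if `[< good qr >] then F @^-1` box qr else set0).
  apply/seteqP; split => [w /= Aw|w [qr _]]; last first.
    by case: asboolP => // gqr /= bw; exact: gqr (DF w) bw.
  have [e e0 he] := Aopen _ Aw (DF w).
  have e2 : 0 < e / 2 by rewrite divr_gt0.
  (* Two points of a box of radius [r] differ by less than [2 * r < e]. *)
  have /rat_in_itvoo[r] := e2; rewrite in_itv /= => /andP[r0 re].
  have rk k : exists q : rat, `|ratr q - F w 0 k| < ratr r :> R.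
    have : F w 0 k - ratr r < F w 0 k + ratr r by lra.
    move=> /rat_in_itvoo[q]; rewrite in_itv /= => /andP[q1 q2].
    by exists q; rewrite ltr_norml; apply/andP; split; lra.
  have [q hq] := choice rk.
  exists ([ffun k => q k], r) => //=.
  have bw : box ([ffun k => q k], r) (F w) by move=> k /=; rewrite ffunE.
  rewrite (asboolT _) // => v Dv bv; apply: he => // k.
  have := bv k; have := bw k => /=; rewrite ffunE => h1 h2.
  rewrite (_ : _ - _ = - (ratr (q k) - F w 0 k) + (ratr (q k) - v 0 k)); last ring.
  apply: le_lt_trans (ler_normD _ _) _; rewrite normrN; lra.
apply: countable_bigcupT_measurable => [|qr]; first exact: countableP.
case: asboolP => // _.
have -> : F @^-1` box qr =
    \big[setI/setT]_(k <- enum 'I_d) [set w | `|ratr (qr.1 k) - F w 0 k| < ratr qr.2].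
  rewrite -bigcap_seq; apply/seteqP; split => w /= h k; first by move=> _; apply: h.
  by apply: h; rewrite /= mem_enum.
apply: bigsetI_measurable => k _.
have mh : measurable_fun [set: M] (fun w => `|ratr (qr.1 k) - F w 0 k| : R).
  by apply: measurableT_comp => //; apply: measurable_funB => //; exact: mF.
rewrite (_ : mkset _ = setT `&`
    (fun w => `|ratr (qr.1 k) - F w 0 k| : R) @^-1` `]-oo, ratr qr.2[).
  by apply: mh => //; exact: measurable_itv.
by rewrite setTI; apply/seteqP; split => w /=; rewrite in_itv.
Qed.

Lemma measurable_rV F : coord_measurable F ->
  measurable_fun [set: M] (F : M -> borel_rV R d).
Proof.
move=> mF; apply: (@measurability _ _ M (borel_rV R d) setT F (@open 'rV[R]_d)) => //.
move=> _ [A oA <-].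
rewrite setTI; apply: (@measurable_preimage_relopen _ setT) => // v Av _.
move: oA; rewrite openE => /(_ _ Av); rewrite /interior.
move=> /nbhs_ballP[e /= e0 he]; exists e => // v' _ h; apply: he.
by split => // i k; rewrite ord1; exact: h.
Qed.

Lemma measurable_comp_lipschitz F D (h : 'rV[R]_d -> R) (L : R) :
  coord_measurable F -> (forall w, D (F w)) -> lipschitz_in L D h ->
  measurable_fun [set: M] (h \o F).
Proof.
move=> mF DF hL; apply: (measurability _ (RGenOInfty.measurableE R)) => //.
move=> _ [_ [r ->] <-]; rewrite setTI.
rewrite (_ : _ @^-1` _ = F @^-1` [set v | r < h v]); last first.
  by apply/seteqP; split => w /=; rewrite in_itv /= andbT.
apply: (measurable_preimage_relopen mF DF) => v /= rv Dv.
pose K := `|L| * d%:R + 1.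
have K0 : 0 < K by rewrite ltr_wpDl// mulr_ge0.
exists ((h v - r) / K); first by rewrite divr_gt0// subr_gt0.
move=> v' Dv' hv'.
have h1 : enorm (v - v') <= d%:R * ((h v - r) / K).
  apply: le_trans (enorm_le_sum _) _.
  rewrite mulr_natl -[X in _ *+ X]card_ord -sumr_const.
  by apply: ler_sum => k _; rewrite !mxE ltW.
have h2 := hL v v' Dv Dv'.
have h3 : `|h v - h v'| < h v - r.
  apply: le_lt_trans h2 _; apply: (@le_lt_trans _ _ (`|L| * enorm (v - v'))).
    by rewrite ler_wpM2r ?enorm_ge0 ?ler_norm.
  apply: (@le_lt_trans _ _ (`|L| * (d%:R * ((h v - r) / K)))).
    by rewrite ler_wpM2l.
  have -> : `|L| * (d%:R * ((h v - r) / K)) = (h v - r) * (`|L| * d%:R / K).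
    by move: (h v - r) (K^-1) `|L| => e k l; ring.
  rewrite gtr_pMr ?subr_gt0// ltr_pdivrMr// mul1r /K.
  by rewrite ltrDl.
by move: h3; rewrite ltr_norml => /andP[_]; lra.
Qed.

End Maps.

Lemma coord_measurable_borel : coord_measurable (id : borel_rV R d -> 'rV[R]_d).
Proof.
move=> k; apply: (measurability _ (RGenOInfty.measurableE R)) => //.
move=> _ [_ [r ->] <-]; rewrite setTI; apply: sub_sigma_algebra.
apply: (@open_comp _ _ (fun v : 'rV[R]_d => v 0 k) `]r, +oo[) => [v _|].
  exact: coord_continuous.
exact: interval_open.
Qed.

Lemma coord_measurable_comp {disp disp' : measure_display}
    {M : measurableType disp} {M' : measurableType disp'}
    (F : M -> 'rV[R]_d) (phi : M' -> M) :
  coord_measurable F -> measurable_fun setT phi -> coord_measurable (F \o phi).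
Proof. by move=> mF mphi k; apply: measurableT_comp (mF k) mphi. Qed.

Section Operations.
Context {disp : measure_display} {M : measurableType disp}.
Implicit Types (F G : M -> 'rV[R]_d).

Lemma coord_measurable_of_borel (U : M -> borel_rV R d) :
  measurable_fun setT U -> coord_measurable (U : M -> 'rV[R]_d).
Proof. by move=> mU; exact: coord_measurable_comp coord_measurable_borel mU. Qed.

Lemma coord_measurable_cst v : coord_measurable (fun _ : M => v : 'rV[R]_d).
Proof. by move=> k; exact: measurable_cst. Qed.

Lemma coord_measurableD F G : coord_measurable F -> coord_measurable G ->
  coord_measurable (fun w => F w + G w).
Proof.
move=> mF mG k.
under [X in measurable_fun _ X]eq_fun do rewrite mxE.
exact: measurable_funD.
Qed.

Lemma coord_measurableZ (h : M -> R) F : measurable_fun setT h ->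
  coord_measurable F -> coord_measurable (fun w => h w *: F w).
Proof.
move=> mh mF k.
under [X in measurable_fun _ X]eq_fun do rewrite mxE.
exact: measurable_funM.
Qed.

Lemma coord_measurable_sum (I : Type) (r : seq I) (F : I -> M -> 'rV[R]_d) :
  (forall i, coord_measurable (F i)) ->
  coord_measurable (fun w => \sum_(i <- r) F i w).
Proof.
move=> mF k; under [X in measurable_fun _ X]eq_fun do rewrite summxE.
by apply: measurable_sum => i; exact: mF.
Qed.

Lemma measurable_dot F G : coord_measurable F -> coord_measurable G ->
  measurable_fun [set: M] (fun w => dot (F w) (G w)).
Proof.
by move=> mF mG; apply: measurable_sum => k; exact: measurable_funM.
Qed.

(** The projection is nonexpansive, hence each of its coordinates is Lipschitz. *)
Lemma coord_measurable_eproj (X : set 'rV[R]_d) (ru : R) F : closed X ->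
  convex_set (X : set (convex_lmodType 'rV[R]_d)) ->
  (forall z, X z -> enorm z <= ru) -> X 0 ->
  coord_measurable F -> coord_measurable (fun w => eproj X (F w)).
Proof.
move=> Xcl Xcv Xb X0 mF k.
apply: (@measurable_comp_lipschitz _ _ F setT (fun v => eproj X v 0 k) 1) => //.
move=> v v' _ _; rewrite mul1r.
apply: le_trans (eproj_nonexpansive Xcl Xcv Xb X0 v v').
by have := coord_le_enorm (eproj X v - eproj X v') k; rewrite !mxE.
Qed.

End Operations.
End VectorMeasurability.

(** * Random directions on the sphere *)

Section Reflection.
Context {R : realType} {d : nat}.
Implicit Types (v w x y : 'rV[R]_d).

Lemma dot_mulmx x y : dot x y = (x *m y^T) 0 0.
Proof. by rewrite mxE; apply: eq_bigr => k _; rewrite mxE. Qed.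

Definition reflection w : 'M[R]_d := 1%:M - (2 / dot w w) *: (w^T *m w).

Lemma mul_reflection w v :
  v *m reflection w = v - (2 / dot w w * dot v w) *: w.
Proof.
rewrite mulmxBr mulmx1 -scalemxAr mulmxA (mx11_scalar (v *m w^T)) -dot_mulmx.
by rewrite mul_scalar_mx scalerA.
Qed.

Lemma reflectionT w : (reflection w)^T = reflection w.
Proof.
by rewrite linearB/= linearZ/= trmx1 trmx_mul trmxK.
Qed.

Lemma reflectionK w v : v *m reflection w *m reflection w = v.
Proof.
rewrite !mul_reflection dotBl dotZl.
have [w0|w0] := eqVneq (dot w w) 0.
  by rewrite (dotxx_eq0 w0) !scaler0 !subr0.
rewrite -addrA -opprD -scalerDl [X in X *: _](_ : _ = 0) ?scale0r ?subr0//.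
by field.
Qed.

Lemma reflection_orthogonal w : reflection w *m (reflection w)^T = 1%:M.
Proof.
rewrite reflectionT; apply/row_matrixP => i.
have e : row i (reflection w) = row i 1%:M *m reflection w.
  by rewrite -row_mul mul1mx.
by rewrite row_mul e reflectionK.
Qed.

Lemma dot_reflection w x y :
  dot (x *m reflection w) y = dot x (y *m reflection w).
Proof. by rewrite !mul_reflection !dotE (dotC y w); ring. Qed.

Lemma reflection_self w : w *m reflection w = - w.
Proof.
have [w0|w0] := eqVneq (dot w w) 0; first by rewrite (dotxx_eq0 w0) mul0mx oppr0.
by rewrite mul_reflection divfK// scaler_nat mulr2n opprD addrA subrr sub0r.
Qed.

Lemma reflection_swap x y : dot x x = dot y y -> x *m reflection (x - y) = y.
Proof.
move=> xy; rewrite mul_reflection.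
have [w0|w0] := eqVneq (dot (x - y) (x - y)) 0.
  by rewrite (dotxx_eq0 w0) scaler0 subr0; apply: subr0_eq; exact: dotxx_eq0.
rewrite (_ : 2 / _ * _ = 1) ?scale1r ?subKr//.
have e : dot (x - y) (x - y) = 2 * dot x (x - y).
  by rewrite !dotE -xy (dotC y x); ring.
by rewrite -mulrA mulrCA -e mulVf.
Qed.

Lemma dot_orthogonal (Q : 'M[R]_d) x y : Q *m Q^T = 1%:M ->
  dot (x *m Q) (y *m Q) = dot x y.
Proof.
by move=> QQ; rewrite !dot_mulmx trmx_mul mulmxA -(mulmxA x) QQ mulmx1.
Qed.

End Reflection.

Section BoundedMeasurable.
Context {R : realType} {disp : measure_display} {M : measurableType disp}.
Implicit Types (h g : M -> R).

Definition bounded_measurable h :=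
  measurable_fun [set: M] h /\ exists K, forall w, `|h w| <= K.

Lemma bounded_measurable_cst (r : R) : bounded_measurable (fun _ => r).
Proof. by split; [exact: measurable_cst | exists `|r|]. Qed.

Lemma bounded_measurableD h g : bounded_measurable h -> bounded_measurable g ->
  bounded_measurable (fun w => h w + g w).
Proof.
move=> [mh [K hK]] [mg [L gL]]; split; first exact: measurable_funD.
by exists (K + L) => w; apply: le_trans (ler_normD _ _) _; exact: lerD.
Qed.

Lemma bounded_measurableM h g : bounded_measurable h -> bounded_measurable g ->
  bounded_measurable (fun w => h w * g w).
Proof.
move=> [mh [K hK]] [mg [L gL]]; split; first exact: measurable_funM.
by exists (K * L) => w; rewrite normrM; exact: ler_pM.
Qed.

Lemma bounded_measurableB h g : bounded_measurable h -> bounded_measurable g ->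
  bounded_measurable (fun w => h w - g w).
Proof.
move=> [mh [K hK]] [mg [L gL]]; split; first exact: measurable_funB.
by exists (K + L) => w; apply: le_trans (ler_normB _ _) _; exact: lerD.
Qed.

Lemma bounded_measurable_sum (I : Type) (r : seq I) (F : I -> M -> R) :
  (forall i, bounded_measurable (F i)) ->
  bounded_measurable (fun w => \sum_(i <- r) F i w).
Proof.
move=> bF; elim: r => [|i r IH].
  under eq_fun do rewrite big_nil; exact: bounded_measurable_cst.
by under eq_fun do rewrite big_cons; exact: bounded_measurableD.
Qed.

Variable P : probability M R.

Lemma bounded_measurable_integrable h : bounded_measurable h ->
  P.-integrable [set: M] (EFin \o h).
Proof.
move=> [mh [K hK]]; apply: measurable_bounded_integrable => //.
  exact: le_lt_trans (probability_le1 P measurableT) (ltry 1).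
exists K; split; first exact: num_real.
by move=> K' KK' w _; exact: le_trans (hK w) (ltW KK').
Qed.

Lemma Rintegral_prob_cst (r : R) : \int[P]_w r = r.
Proof.
rewrite Rintegral_cst// -[RHS]mulr1; congr (_ * _).
by rewrite -[RHS]/(fine 1%E); congr fine; exact: probability_setT.
Qed.

Lemma Rintegral_le h g : bounded_measurable h -> bounded_measurable g ->
  (forall w, h w <= g w) -> \int[P]_w h w <= \int[P]_w g w.
Proof.
by move=> bh bg hg; apply: le_Rintegral => //; exact: bounded_measurable_integrable.
Qed.

Lemma Rintegral_add h g : bounded_measurable h -> bounded_measurable g ->
  \int[P]_w (h w + g w) = \int[P]_w h w + \int[P]_w g w.
Proof.
by move=> bh bg; apply: RintegralD => //; exact: bounded_measurable_integrable.
Qed.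

Lemma Rintegral_sub h g : bounded_measurable h -> bounded_measurable g ->
  \int[P]_w (h w - g w) = \int[P]_w h w - \int[P]_w g w.
Proof.
by move=> bh bg; apply: RintegralB => //; exact: bounded_measurable_integrable.
Qed.

Lemma Rintegral_mull h r : bounded_measurable h ->
  \int[P]_w (r * h w) = r * \int[P]_w h w.
Proof.
by move=> bh; apply: RintegralZl => //; exact: bounded_measurable_integrable.
Qed.

Lemma Rintegral_bigsum (I : Type) (r : seq I) (F : I -> M -> R) :
  (forall i, bounded_measurable (F i)) ->
  \int[P]_w (\sum_(i <- r) F i w) = \sum_(i <- r) \int[P]_w F i w.
Proof.
move=> bF; elim: r => [|i r IH].
  under eq_Rintegral do rewrite big_nil.
  by rewrite Rintegral_prob_cst big_nil.
under eq_Rintegral do rewrite big_cons.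
rewrite big_cons -IH Rintegral_add//.
exact: bounded_measurable_sum.
Qed.

End BoundedMeasurable.

Section UniformDirection.
Context {R : realType} {d : nat} (d_gt0 : (0 < d)%N).
Context {disp : measure_display} {M : measurableType disp}.
Variables (P : probability M R) (u : M -> borel_rV R d).
Hypotheses (mu : measurable_fun [set: M] u)
  (u_sphere : forall w, enorm (u w) = 1)
  (u_inv : forall Q : 'M[R]_d, Q *m Q^T = 1%:M ->
     forall B : set (borel_rV R d), measurable B ->
       P (u @^-1` [set v | B ((v : 'rV[R]_d) *m Q)]) = P (u @^-1` B)).

(** A Borel map into the unit ball which fixes the sphere: composing with it
    turns a function that is only known on the ball into a Borel function. *)
Definition clamp (v : borel_rV R d) : 'rV[R]_d :=
  if dot (v : 'rV[R]_d) v == 1 then v else 0.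

Lemma clamp_sphere (v : 'rV[R]_d) : enorm v = 1 -> clamp v = v.
Proof. by move=> /enorm_eq1 v1; rewrite /clamp v1 eqxx. Qed.

Lemma clamp_ball v : eball (clamp v).
Proof.
rewrite /eball /= /clamp; case: ifP => [/eqP v1|_].
  by rewrite enorm_leP// v1 expr1n.
by rewrite enorm_leP// dot0l expr1n.
Qed.

Lemma coord_measurable_clamp : coord_measurable clamp.
Proof.
move=> k; rewrite (_ : (fun _ => _) = (fun v : borel_rV R d =>
  if dot (v : 'rV[R]_d) v == 1 then (v : 'rV[R]_d) 0 k else 0)); last first.
  by apply/funext => v; rewrite /clamp; case: ifP => //; rewrite mxE.
apply: measurable_fun_ifT => //; last exact: coord_measurable_borel.
apply: measurable_fun_eqr => //.
by apply: measurable_dot; exact: coord_measurable_borel.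
Qed.

Lemma sphere_invariance (Q : 'M[R]_d) (h : 'rV[R]_d -> R) :
  Q *m Q^T = 1%:M -> bounded_measurable (h \o clamp) ->
  \int[P]_w h (u w *m Q) = \int[P]_w h (u w).
Proof.
move=> QQ bh.
have uQ_sphere w : enorm (u w *m Q) = 1.
  rewrite /enorm -(u_sphere w); congr Num.sqrt.
  by have := dot_orthogonal (u w) (u w) QQ.
have muQ : measurable_fun [set: M] (fun w => (u w *m Q) : borel_rV R d).
  apply: measurable_rV => k.
  rewrite (_ : (fun _ => _) = (fun w => \sum_(j < d) (u w : 'rV[R]_d) 0 j * Q j k)).
    apply: measurable_sum => j; apply: measurable_funM => //.
    exact: (coord_measurable_of_borel mu).
  by apply/funext => w; rewrite mxE.
rewrite (_ : (fun w => h (u w *m Q)) = (fun w => (h \o clamp) (u w *m Q))); last first.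
  by apply/funext => w /=; rewrite clamp_sphere.
rewrite (_ : (fun w => h (u w)) = (fun w => (h \o clamp) (u w))); last first.
  by apply/funext => w /=; rewrite clamp_sphere.
have bint (phi : M -> borel_rV R d) : measurable_fun setT phi ->
    P.-integrable [set: M] (EFin \o (h \o clamp) \o phi).
  move=> mphi; apply: (@bounded_measurable_integrable _ _ _ P (h \o clamp \o phi)).
  case: bh => mh [K hK]; split; last by exists K => w; exact: hK.
  exact: measurableT_comp mh mphi.
have mh : measurable_fun setT (EFin \o (h \o clamp)).
  by apply/measurable_EFinP; case: bh.
congr fine.
rewrite -[LHS](@integral_pushforward _ _ _ _ _ _ muQ P setT _ mh (bint _ muQ))//.
rewrite -[RHS](@integral_pushforward _ _ _ _ _ _ mu P setT _ mh (bint _ mu))//.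
apply: eq_measure_integral => B mB _; exact: (u_inv QQ mB).
Qed.

Let bm_dot z : bounded_measurable (fun v => dot (clamp v) z).
Proof.
split.
  by apply: measurable_dot; [exact: coord_measurable_clamp|exact: coord_measurable_cst].
exists (enorm z) => v; apply: le_trans (normr_dot_le _ _) _.
by rewrite ler_piMl ?enorm_ge0//; exact: clamp_ball.
Qed.

Lemma bounded_measurable_on_sphere (h : 'rV[R]_d -> R) :
  bounded_measurable (h \o clamp) -> bounded_measurable (fun w => h (u w)).
Proof.
move=> [mh [K hK]].
rewrite (_ : (fun w => h (u w)) = (h \o clamp) \o u).
  by split; [exact: measurableT_comp mh mu | exists K => w; exact: hK].
by apply/funext => w /=; rewrite clamp_sphere.
Qed.

Lemma mean_direction z : \int[P]_w dot (u w) z = 0.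
Proof.
have := @sphere_invariance _ (fun v => dot v z) (reflection_orthogonal z) (bm_dot z).
under eq_Rintegral do rewrite dot_reflection reflection_self dotNr -mulN1r.
rewrite Rintegral_mull; last first.
  exact: (@bounded_measurable_on_sphere (fun v => dot v z) (bm_dot z)).
by move=> h; move: h; lra.
Qed.

(** The second moment is isotropic, because a reflection moves [z] onto the
    vector of the same length along any coordinate axis, and has trace [1]. *)
Lemma second_moment_direction z :
  \int[P]_w (dot (u w) z) ^+ 2 = dot z z / d%:R.
Proof.
have bm2 y : bounded_measurable (fun v => dot (clamp v) y ^+ 2).
  by under eq_fun do rewrite expr2; apply: bounded_measurableM; exact: bm_dot.
have bmu2 y := @bounded_measurable_on_sphere (fun v => dot v y ^+ 2) (bm2 y).
pose e k : 'rV[R]_d := enorm z *: delta_mx 0 k.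
have dote v k : dot v (e k) = enorm z * v 0 k.
  rewrite dotZr /dot (bigD1 k)//= mxE !eqxx mulr1 big1 ?addr0// => j jk.
  by rewrite mxE eqxx (negbTE jk) mulr0.
have ee k : dot z z = dot (e k) (e k).
  by rewrite dote !mxE !eqxx mulr1 -expr2 sqr_enorm.
have eqk k : \int[P]_w (dot (u w) z) ^+ 2 = \int[P]_w (dot (u w) (e k)) ^+ 2.
  have := @sphere_invariance _ (fun v => dot v z ^+ 2)
    (reflection_orthogonal (z - e k)) (bm2 z).
  by under eq_Rintegral do rewrite dot_reflection (reflection_swap (ee k)).
have : \sum_(k < d) \int[P]_w (dot (u w) z) ^+ 2 = dot z z.
  rewrite (eq_bigr _ (fun k _ => eqk k)) -Rintegral_bigsum//.
  rewrite (_ : (fun w => _) = (fun=> dot z z)) ?Rintegral_prob_cst//.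
  apply/funext => w; under eq_bigr do rewrite dote exprMn.
  rewrite -mulr_sumr sqr_enorm -[RHS]mulr1; congr (_ * _).
  by rewrite -(enorm_eq1 (u_sphere w)); apply: eq_bigr => k _; rewrite expr2.
rewrite sumr_const card_ord => h.
rewrite -[X in X / _]h -[X in X / _]mulr_natr mulfK// pnatr_eq0 -lt0n.
exact: d_gt0.
Qed.

Variables (X : set 'rV[R]_d) (f : 'rV[R]_d -> R) (L delta : R).
Hypotheses (L_ge0 : 0 <= L) (delta_gt0 : 0 < delta)
  (f_convex : convex_function
     ([set: 'rV[R]_d] : set (convex_lmodType 'rV[R]_d)) f)
  (f_lip : lipschitz_in L (dilate X delta (@eball R d)) f).

Let in_dilate x v : X x -> enorm v <= 1 ->
  dilate X delta (@eball R d) (x + delta *: v).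
Proof. by move=> Xx v1; exists x => //; exists v. Qed.

Lemma in_dilate_center x : X x -> dilate X delta (@eball R d) x.
Proof.
move=> Xx; have := @in_dilate x 0 Xx; rewrite scaler0 addr0; apply.
by rewrite enorm_leP// dot0l expr1n.
Qed.

Let lip_center x v : X x -> enorm v <= 1 ->
  `|f (x + delta *: v) - f x| <= delta * L.
Proof.
move=> Xx v1.
apply: le_trans (f_lip (in_dilate Xx v1) (in_dilate_center Xx)) _.
rewrite addrC addKr enormZ gtr0_norm// mulrC -mulrA ler_pM2l//.
by rewrite ler_piMl.
Qed.

(** Slopes of a convex function increase along a line: the chord from [p] to
    [p + s z] is at most as steep as the full step [z] that continues it. *)
Let slope_le (p z : 'rV[R]_d) (s K : R) : 0 <= s ->
  f (p + s *: z + z) - f (p + s *: z) <= K ->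
  f (p + s *: z) - f p <= s * K.
Proof.
move=> s0 hK.
(* [p + s z] is the convex combination of [p + (s + 1) z] and [p] whose weight
   on [p] is [1 / (1 + s)]. *)
have t01 : 0 <= 1 / (1 + s) <= 1.
  by rewrite divr_ge0 ?addr_ge0//= ler_pdivrMr ?mul1r ?lerDl// ltr_wpDr.
have s1 : 1 + s != 0 by rewrite gt_eqF// ltr_wpDr.
have := conv_ler p (p + s *: z + z) f_convex t01.
rewrite (_ : _ *: p + _ = p + s *: z); last first.
  by apply/rowP => k; rewrite !mxE; field.
set A := f p; set B := f _; set C := f _ => h.
have h2 : (1 + s) * B <= A + s * C.
  have s1' : 0 < 1 + s by rewrite ltr_wpDr.
  apply: le_trans (ler_wpM2l (ltW s1') h) _.
  by rewrite le_eqVlt; apply/orP; left; apply/eqP; field.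
have := ler_wpM2l s0 hK; rewrite -/C -/B; lra.
Qed.

Lemma bounded_measurable_perturbed x : X x ->
  bounded_measurable (fun v => f (x + delta *: clamp v)).
Proof.
move=> Xx; split.
  apply: (@measurable_comp_lipschitz _ _ _ _ (fun v => x + delta *: clamp v)
    (dilate X delta (@eball R d)) f L) => // [|v]; last exact/in_dilate/clamp_ball.
  apply: coord_measurableD; first exact: coord_measurable_cst.
  by apply: coord_measurableZ => //; exact: coord_measurable_clamp.
exists (`|f x| + delta * L) => v.
rewrite -[f (x + _)](subrK (f x)) addrC.
apply: le_trans (ler_normD _ _) _; rewrite lerD2l.
by apply: lip_center => //; exact: clamp_ball.
Qed.

(** The estimator is an approximate subgradient. Pairing each direction with
    its mirror image along [z = y - x] leaves a difference of [f] along a chord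
    parallel to [z], of length proportional to the component of the direction
    along [z]; convexity bounds its slope by that of the chord from [x] to [y],
    and the second moment [1 / d] cancels the factor [d]. *)
Lemma estimator_subgradient x y (c : R) : X x -> X y ->
  f x - f y - 2 * delta * L <=
  \int[P]_w (d%:R / delta * (f (x + delta *: u w) - c) * dot (u w) (x - y)).
Proof.
move=> Xx Xy; set z := y - x; set K := f y - f x + 2 * delta * L.
have bf := bounded_measurable_perturbed Xx.
have bz := bm_dot z.
have bfz := bounded_measurableM bf bz.
have bfu := @bounded_measurable_on_sphere (fun v => f (x + delta *: v)) bf.
have bfzu := @bounded_measurable_on_sphere
  (fun v => f (x + delta *: v) * dot v z) bfz.
have bzu := @bounded_measurable_on_sphere (fun v => dot v z) bz.
have bzzu := bounded_measurableM bzu bzu.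
have d0 : (d%:R : R) != 0 by rewrite pnatr_eq0 -lt0n.
set I := \int[P]_w (f (x + delta *: u w) * dot (u w) z).
have I_le : I <= delta * K / d%:R.
  have [z0|z0] := eqVneq (dot z z) 0.
    have /subr0_eq yx : y - x = 0 by exact: dotxx_eq0.
    have -> : I = 0.
      rewrite /I (_ : (fun w => _) = (fun=> 0)) ?Rintegral_prob_cst//.
      apply/funext => w; rewrite (_ : z = 0) ?(dotC _ 0) ?dot0l ?mulr0//.
      exact: dotxx_eq0.
    rewrite divr_ge0// mulr_ge0 ?(ltW delta_gt0)// /K yx subrr add0r.
    by rewrite !mulr_ge0 ?(ltW delta_gt0).
  have zz : 0 < dot z z by rewrite lt_def z0 dot_ge0.
  have hI := @sphere_invariance _ (fun v => f (x + delta *: v) * dot v z)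
    (reflection_orthogonal z) bfz.
  have bR : bounded_measurable
      (fun w => f (x + delta *: (u w *m reflection z)) * dot (u w) z).
    apply: bounded_measurableM => //.
    have uR w : enorm (u w *m reflection z) = 1.
      rewrite /enorm -(u_sphere w); congr Num.sqrt.
      by have := dot_orthogonal (u w) (u w) (reflection_orthogonal z).
    split; last first.
      exists (`|f x| + delta * L) => w.
      rewrite -[f (x + _)](subrK (f x)) addrC.
      apply: le_trans (ler_normD _ _) _; rewrite lerD2l.
      by apply: lip_center => //; rewrite uR.
    apply: (@measurable_comp_lipschitz _ _ _ _
      (fun w => x + delta *: (u w *m reflection z))
      (dilate X delta (@eball R d)) f L) => // [|w]; last by apply/in_dilate; rewrite ?uR.
    apply: coord_measurableD; first exact: coord_measurable_cst.
    apply: coord_measurableZ => //.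
    under eq_fun do rewrite mul_reflection -scaleNr.
    have mu' := coord_measurable_of_borel mu.
    apply: coord_measurableD => //; apply: coord_measurableZ.
      apply: measurable_funN; apply: measurable_funM => //.
      by case: bzu.
    exact: coord_measurable_cst.
  have twoI : 2 * I = \int[P]_w ((f (x + delta *: u w)
      - f (x + delta *: (u w *m reflection z))) * dot (u w) z).
    under eq_Rintegral do rewrite mulrBl.
    rewrite Rintegral_sub// -/I.
    have -> : \int[P]_w (f (x + delta *: (u w *m reflection z)) * dot (u w) z) = - I.
      rewrite -mulN1r -[X in -1 * X]hI -Rintegral_mull.
        apply: eq_Rintegral => w _.
        by rewrite dot_reflection reflection_self dotNr; ring.
      have -> : (fun w => f (x + delta *: (u w *m reflection z)) *
          dot (u w *m reflection z) z) =
          (fun w => -1 * (f (x + delta *: (u w *m reflection z)) * dot (u w) z)).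
        by apply/funext => w; rewrite dot_reflection reflection_self dotNr; ring.
      by apply: bounded_measurableM => //; exact: bounded_measurable_cst.
    by ring.
  have pointwise w : (f (x + delta *: u w)
      - f (x + delta *: (u w *m reflection z))) * dot (u w) z
      <= 2 * delta / dot z z * K * dot (u w) z ^+ 2.
    set v := u w : 'rV[R]_d; set b := dot v z; set v' := v *m reflection z.
    have v1 : enorm v <= 1 by rewrite u_sphere.
    have v'1 : enorm v' <= 1.
      by rewrite -(u_sphere w) /enorm ler_sqrt ?dot_ge0// le_eqVlt; apply/orP; left;
         apply/eqP; exact: (dot_orthogonal v v (reflection_orthogonal z)).
    have v'E : v' = v - (2 / dot z z * b) *: z by rewrite /v' mul_reflection.
    have key q : enorm q <= 1 ->
        f (x + delta *: q + z) - f (x + delta *: q) <= K.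
      move=> q1; rewrite (_ : x + delta *: q + z = y + delta *: q); last first.
        by rewrite /z addrC addrA subrK.
      have := lip_center Xx q1; have := lip_center Xy q1.
      rewrite !ler_norml => /andP[_ h1] /andP[h2 _]; rewrite /K; lra.
    (* Exchanging the direction with its mirror image changes the sign of both
       factors, so the chord may be run through in the sense of [z]. *)
    have [b0|b0] := leP 0 b.
      have s0 : 0 <= 2 * delta / dot z z * b.
        by rewrite mulr_ge0// divr_ge0 ?(ltW zz)// mulr_ge0// ltW.
      have e : x + delta *: v = x + delta *: v' + (2 * delta / dot z z * b) *: z.
        by rewrite v'E; apply/rowP => k; rewrite !mxE; ring.
      have := slope_le s0 (_ : f (x + delta *: v' + _ *: z + z) - _ <= K).
      rewrite -e => /(_ (key _ v1)) h.
      apply: le_trans (ler_wpM2r b0 h) _.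
      by rewrite le_eqVlt; apply/orP; left; apply/eqP; ring.
    have b1 : 0 <= - b by rewrite oppr_ge0 ltW.
    have s0 : 0 <= 2 * delta / dot z z * (- b).
      by rewrite mulr_ge0// divr_ge0 ?(ltW zz)// mulr_ge0// ltW.
    have e : x + delta *: v' = x + delta *: v + (2 * delta / dot z z * - b) *: z.
      by rewrite v'E; apply/rowP => k; rewrite !mxE; ring.
    have := slope_le s0 (_ : f (x + delta *: v + _ *: z + z) - _ <= K).
    rewrite -e => /(_ (key _ v'1)) h.
    rewrite -mulrNN opprB.
    apply: le_trans (ler_wpM2r b1 h) _.
    by rewrite le_eqVlt; apply/orP; left; apply/eqP; ring.
  have : 2 * I <= 2 * delta / dot z z * K * (dot z z / d%:R).
    rewrite -second_moment_direction -Rintegral_mull; last first.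
      by under eq_fun do rewrite expr2.
    rewrite twoI; apply: Rintegral_le => //.
      under eq_fun do rewrite mulrBl; exact: bounded_measurableB.
    apply: bounded_measurableM; first exact: bounded_measurable_cst.
    by under eq_fun do rewrite expr2.
  have -> : 2 * delta / dot z z * K * (dot z z / d%:R) = 2 * (delta * K / d%:R).
    by field; rewrite z0 d0.
  by rewrite ler_pM2l.
have -> : \int[P]_w (d%:R / delta * (f (x + delta *: u w) - c) * dot (u w) (x - y))
    = - (d%:R / delta) * I.
  rewrite (_ : (fun w => _) = (fun w => (- (d%:R / delta)) *
      (f (x + delta *: u w) * dot (u w) z - c * dot (u w) z))); last first.
    by apply/funext => w; rewrite /z -(opprB x y) dotNr; ring.
  have bc : bounded_measurable (fun w => c * dot (u w) z).
    by apply: bounded_measurableM => //; exact: bounded_measurable_cst.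
  rewrite Rintegral_mull; last exact: bounded_measurableB.
  by rewrite Rintegral_sub// Rintegral_mull// mean_direction mulr0 subr0.
have dd : 0 < d%:R / delta by rewrite divr_gt0// ltr0n.
have := ler_wpM2l (ltW dd) I_le.
have -> : d%:R / delta * (delta * K / d%:R) = K.
  by field; rewrite d0 gt_eqF.
by rewrite /K mulNr; lra.
Qed.

End UniformDirection.

(** * Independence of a direction from the past *)

Section Independence.
Context {R : realType} {d1 d2 : measure_display}.
Context {Om : measurableType d1} {S : measurableType d2}.
Variables (P : probability Om R) (I : choiceType) (U : I -> Om -> S).
Hypotheses (mU : forall k, measurable_fun [set: Om] (U k)).

Definition cylinders (s : seq I) : set (set Om) :=
  [set C | exists2 B : I -> set S, (forall k, measurable (B k)) &
     C = \big[setI/setT]_(k <- s) (U k @^-1` B k)].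

(** The past as a measurable space of its own, whose measurable sets are the
    events decided by the variables indexed by [s]. *)
Definition history (s : seq I) := g_sigma_algebraType (cylinders s).

Lemma history_measurable s k : k \in s ->
  measurable_fun [set: history s] (U k : history s -> S).
Proof.
move=> ks _ B mB; rewrite setTI; apply: sub_sigma_algebra.
exists (fun j => if j == k then B else setT).
  by move=> j; case: ifP => _ //; exact: measurableT.
rewrite -bigcap_seq; apply/seteqP; split => w /= h.
  by move=> j _; case: eqVneq => [->|].
by have := h k ks; rewrite eqxx.
Qed.

Lemma history_sub s (A : set (history s)) :
  measurable A -> measurable (A : set Om).
Proof.
apply: smallest_sub; first exact: sigma_algebra_measurable.
move=> _ [B mB ->]; apply: bigsetI_measurable => k _.
by rewrite -[X in measurable X]setTI; exact: (mU k measurableT (mB k)).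
Qed.

Lemma history_id_measurable s :
  measurable_fun [set: Om] (id : Om -> history s).
Proof. by move=> _ A mA; rewrite setTI; exact: (history_sub mA). Qed.

Hypothesis U_indep : forall (s : seq I) (B : I -> set S), uniq s ->
  (forall k, measurable (B k)) ->
  P (\big[setI/setT]_(k <- s) (U k @^-1` B k)) =
  (\prod_(k <- s) P (U k @^-1` B k))%E.

Let mfun_of {d d'} {T : measurableType d} {T' : measurableType d'}
    (g : T -> T') (mg : measurable_fun setT g) : {mfun T >-> T'} :=
  mfun_Sub (mem_set mg).

Variables (s : seq I) (k0 : I).
Hypotheses (s_uniq : uniq (k0 :: s)).

(** Both sides are finite measures in [A] that agree on the cylinders, which form
    a generating pi-system. *)
Lemma history_independent (A : set (history s)) (B : set S) :
  measurable A -> measurable B ->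
  P (A `&` U k0 @^-1` B) = (P A * P (U k0 @^-1` B))%E.
Proof.
move=> mA mB; set D := U k0 @^-1` B.
have mD : measurable D by rewrite -[X in measurable X]setTI; exact: (mU k0 measurableT mB).
have PDfin : P D \is a fin_num by exact: fin_num_measure.
have PD0 : 0 <= fine (P D) by rewrite fine_ge0.
pose idM : Om -> history s := id.
have mid : measurable_fun [set: Om] idM := @history_id_measurable s.
pose m1 : {measure set (history s) -> \bar R} := pushforward (mrestr P mD) idM.
pose m2 : {measure set (history s) -> \bar R} :=
  mscale (NngNum PD0) (pushforward P idM).
have m1E C : m1 mid C = P (C `&` D) by [].
have m2E C : m2 mid C = (P C * P D)%E.
  by rewrite muleC -[in RHS](fineK PDfin).
rewrite -m1E -m2E; move: A mA.
apply: (@measure_unique _ R (history s) (cylinders s) (fun=> setT) _ _ _ _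
  (m1 mid) (m2 mid)) => //.
- move=> _ _ [B1 mB1 ->] [B2 mB2 ->].
  exists (fun k => B1 k `&` B2 k); first by move=> k; exact: measurableI.
  by rewrite -big_split.
- move=> _; exists (fun=> setT) => //.
  by rewrite -bigcap_seq; apply/seteqP; split.
- by rewrite bigcup_const.
- move=> _ [B' mB' ->]; rewrite m1E m2E.
  pose B'' k := if k == k0 then B else B' k.
  have mB'' k : measurable (B'' k) by rewrite /B''; case: ifP.
  have ks k : k \in s -> k == k0 = false.
    by move=> kS; apply/eqP => kk; move: s_uniq; rewrite /= -kk kS.
  have e : \big[setI/setT]_(k <- s) (U k @^-1` B' k) =
      \big[setI/setT]_(k <- s) (U k @^-1` B'' k).
    by apply: eq_big_seq => k /ks kk; rewrite /B'' kk.
  have := U_indep s_uniq mB''; rewrite !big_cons.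
  rewrite {1 3}/B'' eqxx -/D setIC -e => ->.
  rewrite muleC; congr (_ * _)%E.
  have := U_indep (andP s_uniq).2 mB''; rewrite -e => ->.
  by [].
- by move=> _; rewrite m1E setTI; apply: le_lt_trans (probability_le1 P mD) (ltry _).
Qed.

(** The pair formed by the history and the direction [U k0] has a product law,
    so an expectation may be computed by freezing the history. *)
Lemma freeze_history (h : history s -> R) (Phi : history s * S -> R) :
  bounded_measurable h -> bounded_measurable Phi ->
  (forall w, h w <= \int[P]_w' Phi (w, U k0 w')) ->
  \int[P]_w h w <= \int[P]_w Phi (w, U k0 w).
Proof.
move=> bh bPhi hPhi.
have mid := @history_id_measurable s.
pose idM := mfun_of mid.
pose u0 := mfun_of (mU k0).
have mpair : measurable_fun [set: Om] (fun w => ((w : history s), U k0 w)).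
  exact: measurable_fun_pair.
pose pr := mfun_of mpair.
pose PM : probability (history s) R := distribution P idM.
pose nu : probability S R := distribution P u0.
pose joint : probability (history s * S)%type R := distribution P pr.
have prodE X : measurable X -> (PM \x nu)%E X = joint X.
  apply: product_measure_unique => A B mA mB.
  exact: (history_independent mA mB).
have mPhi : measurable_fun setT (EFin \o Phi).
  by apply/measurable_EFinP; case: bPhi.
have iPhi : (PM \x nu)%E.-integrable [set: history s * S] (EFin \o Phi).
  apply: measurable_bounded_integrable => //; last 2 first.
  - by case: bPhi.
  - case: bPhi => _ [K PK]; exists K; split; first exact: num_real.
    by move=> K' KK' w _; exact: le_trans (PK w) (ltW KK').
  have h1 : ((PM \x nu)%E setT <= 1)%E.
    rewrite (prodE _ measurableT); exact: probability_le1.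
  exact: le_lt_trans h1 (ltry 1).
have bpair d d' (T : measurableType d) (T' : measurableType d')
    (g : T' -> R) (phi : T -> T') : bounded_measurable g ->
    measurable_fun setT phi -> bounded_measurable (g \o phi).
  move=> [mg [K gK]] mphi; split; last by exists K => w; exact: gK.
  exact: measurableT_comp mg mphi.
have int_comp d (T : measurableType d) (g : T -> R) (phi : Om -> T)
    (mphi : measurable_fun setT phi) : bounded_measurable g ->
    (\int[distribution P (mfun_of mphi)]_x (g x)%:E =
     \int[P]_w (g (phi w))%:E)%E.
  move=> bg; have mg : measurable_fun setT (EFin \o g).
    by apply/measurable_EFinP; case: bg.
  apply: (@integral_pushforward _ _ _ _ _ _ mphi P setT _ mg) => //.
  exact: (bounded_measurable_integrable P (bpair _ _ _ _ _ _ bg mphi)).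
have e1 : (\int[P]_w (Phi (w, U k0 w))%:E =
    \int[PM]_x \int[nu]_y (Phi (x, y))%:E)%E.
  rewrite -(int_comp _ _ _ _ mpair bPhi).
  rewrite (integral12_prod_meas1 iPhi).
  apply: eq_measure_integral => A mA _; exact/esym/prodE.
have e2 : (\int[P]_w (h w)%:E = \int[PM]_x (h x)%:E)%E.
  exact: esym (int_comp _ _ _ _ mid bh).
have bsec x : bounded_measurable (fun y => Phi (x, y)).
  case: bPhi => mP [K PK]; split; last by exists K.
  exact: measurableT_comp mP (measurable_pair1 _).
apply: fine_le.
- exact: (integrable_fin_num _ (bounded_measurable_integrable P
    (bpair _ _ _ _ _ _ bh mid))).
- exact: (integrable_fin_num _ (bounded_measurable_integrable P
    (bpair _ _ _ _ _ _ bPhi mpair))).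
rewrite e1 e2; apply: le_integral => //.
- exact: bounded_measurable_integrable.
- exact: (integrable_fubini_F iPhi).
move=> w _ /=; have := hPhi w.
rewrite -lee_fin /Rintegral fineK.
  by move=> /le_trans; apply; rewrite -(int_comp _ _ _ _ (mU k0) (bsec w)).
exact: (integrable_fin_num _ (bounded_measurable_integrable P
  (bpair _ _ _ _ _ _ (bsec w) (mU k0)))).
Qed.

End Independence.

(** * Regret when every direction lies on the sphere *)

Section Run.
Context {R : realType} {N d : nat}.
Variables (d_gt0 : (0 < d)%N) (a : 'M[R]_N) (c : R).
Hypotheses (c_gt0 : 0 < c) (a_ge0 : forall i j, 0 <= a i j)
  (a_diag : forall i, c <= a i i)
  (a_col : forall j, \sum_(i < N) a i j = 1)
  (a_row : forall i, \sum_(j < N) a i j = 1).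
Variables (X : set 'rV[R]_d) (ru : R).
Hypotheses (X_closed : closed X)
  (X_convex : convex_set (X : set (convex_lmodType 'rV[R]_d)))
  (X_bounded : forall z, X z -> enorm z <= ru) (X0 : X 0) (ru_ge0 : 0 <= ru).
Variables (fm1 : 'I_N -> 'rV[R]_d -> R) (f : nat -> 'I_N -> 'rV[R]_d -> R).
Variables (L delta eta : R).
Hypotheses (L_gt0 : 0 < L) (delta_gt0 : 0 < delta) (eta_gt0 : 0 < eta)
  (f_lip : forall t i,
     lipschitz_in L (dilate X delta (@eball R d)) (lag fm1 f t i)).
Variables (xm1 x0 : 'I_N -> 'rV[R]_d).
Hypotheses (xm1_X : forall i, X (xm1 i)) (x0_X : forall i, X (x0 i)).
Variable T : nat.

Let D := dilate X delta (@eball R d).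

Let perturbed_mem y v : X y -> enorm v <= 1 -> D (y + delta *: v).
Proof. by move=> Xy v1; exists y => //; exists v. Qed.

Let mem_D y : X y -> D y.
Proof.
move=> Xy; have := @perturbed_mem y 0 Xy; rewrite scaler0 addr0; apply.
by rewrite enorm_leP// dot0l expr1n.
Qed.

Let D_bounded y : D y -> enorm y <= ru + delta.
Proof.
move=> [z Xz [v v1 <-]]; apply: le_trans (ler_enormD _ _) _.
by rewrite lerD ?X_bounded// enormZ gtr0_norm// ler_piMr// ltW.
Qed.

Let value_le t i y : D y ->
  `|lag fm1 f t i y| <= `|lag fm1 f t i 0| + L * (ru + delta).
Proof.
move=> Dy; rewrite -[X in `|X|](subrK (lag fm1 f t i 0)) addrC.
apply: le_trans (ler_normD _ _) _; rewrite lerD2l.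
apply: le_trans (@f_lip t i _ _ Dy (mem_D X0)) _.
by rewrite ler_pM2l// subr0 D_bounded.
Qed.

Section Paths.
Context {Om : Type}.
Variables (um1 : 'I_N -> Om -> 'rV[R]_d) (u : nat -> 'I_N -> Om -> 'rV[R]_d).
Hypothesis u_sphere : forall t i w, enorm (lag um1 u t i w) = 1.
Variable x : nat -> 'I_N -> Om -> 'rV[R]_d.
Hypothesis run : orf_run a X eta delta fm1 f xm1 x0 um1 u T x.

Definition increment t i w : R :=
  f t i (x t i w + delta *: u t i w) -
  lag fm1 f t i (lag (fun i _ => xm1 i) x t i w + delta *: lag um1 u t i w).

Definition estimate t i w : 'rV[R]_d :=
  (d%:R / delta * increment t i w) *: u t i w.

Let xE t i w : (t <= T)%N ->
  x t.+1 i w = eproj X (\sum_(j < N) a i j *: (x t j w - eta *: estimate t j w)).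
Proof. by case: run => _; apply. Qed.

Let x0E i w : x 0 i w = x0 i. Proof. by case: run => + _; apply. Qed.

Lemma run_mem t i w : (t <= T.+1)%N -> X (x t i w).
Proof.
case: t => [_|t tT]; first by rewrite x0E.
by rewrite xE//; exact: (eproj_mem X_closed X_bounded X0).
Qed.

Lemma lag_run_mem t i w : (t <= T.+1)%N ->
  X (lag (fun i _ => xm1 i) x t i w).
Proof.
case: t => [_|t tT] /=; first exact: xm1_X.
by apply: run_mem; exact: ltnW.
Qed.

Let increment0_le i w : delta <= 2 ->
  `|increment 0 i w| <= `|f 0 i 0| + `|fm1 i 0| + 2 * (L * (ru + 2)).
Proof.
move=> d2; have u0 := u_sphere 1 i w; have um := u_sphere 0 i w.
rewrite /increment /=; apply: le_trans (ler_normB _ _) _.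
have h1 := @value_le 1 i _ (perturbed_mem (run_mem i w (isT : (0 <= T.+1)%N))
  (eq_ind_r (fun r => r <= 1) (lexx 1) u0)).
have h2 := @value_le 0 i _ (perturbed_mem (xm1_X i)
  (eq_ind_r (fun r => r <= 1) (lexx 1) um)).
have h3 : L * (ru + delta) <= L * (ru + 2) by rewrite ler_pM2l// lerD2l.
move: h1 h2 => /= h1 h2; lra.
Qed.

Let rate t i := increasing_rate X delta (f t i) (f t.-1 i).

Let rate_ub t i y : dilate X delta (@esphere R d) y ->
  `|f t i y - f t.-1 i y| <= rate t i.
Proof.
move=> Dy; apply: ub_le_sup; last by exists y.
have sub : dilate X delta (@esphere R d) `<=` D.
  by move=> _ [z Xz [v v1 <-]]; apply: perturbed_mem => //; rewrite v1.
exists ((`|f t i 0| + L * (ru + delta)) + (`|f t.-1 i 0| + L * (ru + delta))).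
move=> _ [z /sub Dz <-]; apply: le_trans (ler_normB _ _) _; apply: lerD.
  exact: (@value_le t.+1 i z Dz).
exact: (@value_le t.-1.+1 i z Dz).
Qed.

Let rate_ge0 t i (w : Om) : 0 <= rate t i.
Proof.
apply: le_trans (@rate_ub t i (delta *: u 0 i w) _) => //.
exists 0 => //; exists (u 0 i w); last by rewrite add0r.
exact: (u_sphere 1 i w).
Qed.

Let incrementS_le t i w : (t < T)%N ->
  increment t.+1 i w ^+ 2 <= 3 * rate t.+1 i ^+ 2
    + 3 * L ^+ 2 * dot (x t.+1 i w - x t i w) (x t.+1 i w - x t i w)
    + 12 * L ^+ 2 * delta ^+ 2.
Proof.
move=> tT; have u1 := u_sphere t.+2 i w; have u0 := u_sphere t.+1 i w.
rewrite /= in u1 u0.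
(* The old value is compared with the old function at the new point; only the
   latter differs from the new value by the increasing rate. *)
set p := x t.+1 i w + delta *: u t.+1 i w.
set p' := x t i w + delta *: u t i w.
have Dp : D p by apply: perturbed_mem; [exact/run_mem/ltnW|rewrite u1].
have Dp' : D p'.
  by apply: perturbed_mem; [exact/run_mem/ltnW/ltnW|rewrite u0].
have h1 : `|f t.+1 i p - f t i p| <= rate t.+1 i.
  apply: (@rate_ub t.+1); exists (x t.+1 i w); first exact/run_mem/ltnW.
  by exists (u t.+1 i w).
have h2 := @f_lip t.+1 i _ _ Dp Dp'; rewrite /= in h2.
set r := enorm (x t.+1 i w - x t i w).
have h3 : enorm (p - p') <= r + 2 * delta.
  have -> : p - p' = (x t.+1 i w - x t i w) + delta *: (u t.+1 i w - u t i w).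
    by rewrite /p /p'; apply/rowP => k; rewrite !mxE; ring.
  apply: le_trans (ler_enormD _ _) _; rewrite lerD2l enormZ gtr0_norm//.
  rewrite mulrC ler_pM2r//; apply: le_trans (ler_enormD _ _) _.
  by rewrite enormN u1 u0.
have h4 : `|increment t.+1 i w| <= rate t.+1 i + (L * r + L * (2 * delta)).
  rewrite /increment /= -/p -/p'.
  have -> : f t.+1 i p - f t i p' = (f t.+1 i p - f t i p) + (f t i p - f t i p').
    by ring.
  apply: le_trans (ler_normD _ _) _; apply: lerD => //.
  by apply: le_trans h2 _; rewrite -mulrDr ler_pM2l.
have -> : dot (x t.+1 i w - x t i w) (x t.+1 i w - x t i w) = r ^+ 2.
  by rewrite sqr_enorm.
rewrite -(real_normK (num_real (increment _ _ _))).
have r0 : 0 <= r by exact: enorm_ge0.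
apply: (@le_trans _ _ ((rate t.+1 i + (L * r + L * (2 * delta))) ^+ 2)).
  have th0 := rate_ge0 t.+1 i w.
  have Lr : 0 <= L * r by rewrite mulr_ge0// ltW.
  have Ld : 0 <= L * (2 * delta) by rewrite !mulr_ge0// ltW.
  by rewrite ler_pXn2r// nnegrE// !addr_ge0.
have -> : 3 * L ^+ 2 * r ^+ 2 = 3 * (L * r) ^+ 2 by ring.
have -> : 12 * L ^+ 2 * delta ^+ 2 = 3 * (L * (2 * delta)) ^+ 2 by ring.
move: (rate t.+1 i) (L * r) (L * (2 * delta)) => th A B.
have := sqr_ge0 (th - A); have := sqr_ge0 (th - B); have := sqr_ge0 (A - B).
rewrite !expr2; lra.
Qed.

Let rho := eta * d%:R / delta.

Definition initial_energy : R :=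
  \sum_(i < N) (`|f 0 i 0| + `|fm1 i 0| + 2 * (L * (ru + 2))) ^+ 2.

Definition energy_bound (Theta : R) : R :=
  2 * (initial_energy + 3 * Theta ^+ 2
       + 12 * L ^+ 2 * delta ^+ 2 * (T%:R * N%:R)
       + 6 * L ^+ 2 / c * (N%:R * ru ^+ 2)
       + 144 * L ^+ 4 / c ^+ 2 * ru ^+ 2 * rho ^+ 2 * (T.+1%:R * N%:R)).

Hypotheses (delta_le2 : delta <= 2)
  (rho_small : rho ^+ 2 * (6 * L ^+ 2 / c + 6 * L ^+ 2) <= 1 / 4).

Let estimateE t i w :
  eta * enorm (estimate t i w) = rho * `|increment t i w|.
Proof.
have := u_sphere t.+1 i w; rewrite /= /estimate enormZ => ->.
rewrite mulr1 normrM gtr0_norm ?divr_gt0 ?ltr0n// /rho; ring.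
Qed.

(** Projection and averaging with doubly stochastic weights do not increase the
    distances to [xs], so the usual telescoping argument applies to all agents
    together, each with its own function at its own state. *)
Lemma linearized_regret_bound w xs : X xs ->
  \sum_(1 <= t < T.+1) \sum_(i < N) dot (estimate t i w) (x t i w - xs)
  <= (N%:R * (4 * ru ^+ 2) +
      rho ^+ 2 * energy_bound (acc_increasing_rate X delta f T)) / (2 * eta).
Proof.
move=> Xxs; rewrite ler_pdivlMr ?mulr_gt0// mulrC.
have xS t i : (t <= T)%N -> x t.+1 i w =
    eproj X (\sum_(j < N) a i j *: (x t j w - eta *: estimate t j w)).
  exact: xE.
have x0w i : X (x 0 i w) by rewrite x0E.
have := (linearized_regret_le c_gt0 a_ge0 a_diag a_col a_row X_closed
  X_convex X_bounded X0 ru_ge0 (x := fun t i => x t i w)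
  (g := fun t i => estimate t i w) x0w xS Xxs).
move=> /= h; apply: le_trans h _.
rewrite lerD2l.
have D0 : \sum_(i < N) increment 0 i w ^+ 2 <= initial_energy.
  apply: ler_sum => i _; rewrite -(real_normK (num_real (increment _ _ _))).
  have h := increment0_le i w delta_le2.
  rewrite ler_pXn2r// nnegrE//; exact: le_trans (normr_ge0 _) h.
have := @sum_sqr_increment_le _ _ _ a c c_gt0 a_ge0 a_diag a_col a_row X ru
  X_closed X_convex X_bounded X0 ru_ge0 T eta (fun t i => x t i w)
  (fun t i => estimate t i w) (ltW eta_gt0) x0w xS L delta rho initial_energy
  (fun t i => increment t i w) rate L_gt0 D0
  (fun t i => rate_ge0 t i w) (fun t i => @incrementS_le t i w)
  (fun t i => estimateE t i w) rho_small.
rewrite -/(energy_bound _) -/(acc_increasing_rate X delta f T) => h.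
apply: le_trans (ler_wpM2l (sqr_ge0 rho) h).
rewrite [in leRHS]big_nat_recl// big_add1 /= mulrDr.
set A := rho ^+ 2 * \sum_(i < N) _.
have A0 : 0 <= A by rewrite mulr_ge0 ?sqr_ge0// sumr_ge0// => i _; exact: sqr_ge0.
apply: (@le_trans _ _
  (rho ^+ 2 * \sum_(0 <= t < T) \sum_(i < N) increment t.+1 i w ^+ 2)).
  rewrite !mulr_sumr; apply: ler_sum => t _; rewrite !mulr_sumr.
  apply: ler_sum => i _; rewrite -sqr_enorm -exprMn estimateE exprMn.
  by rewrite real_normK ?num_real.
by rewrite lerDr.
Qed.

End Paths.

Section Measurability.
Context {disp : measure_display} {M : measurableType disp}.
Variables (um1 : 'I_N -> M -> 'rV[R]_d) (u : nat -> 'I_N -> M -> 'rV[R]_d).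
Hypothesis u_sphere : forall t i w, enorm (lag um1 u t i w) = 1.
Variable x : nat -> 'I_N -> M -> 'rV[R]_d.
Hypothesis run : orf_run a X eta delta fm1 f xm1 x0 um1 u T x.

Let xl := lag (fun i _ => xm1 i) x.

Let perturbed_measurable t i (y v : M -> 'rV[R]_d) :
  coord_measurable y -> coord_measurable v -> (forall w, X (y w)) ->
  (forall w, enorm (v w) <= 1) ->
  bounded_measurable (fun w => lag fm1 f t i (y w + delta *: v w)).
Proof.
move=> my mv Xy v1; split; last first.
  by exists (`|lag fm1 f t i 0| + L * (ru + delta)) => w; apply/value_le/perturbed_mem.
apply: (@measurable_comp_lipschitz _ _ _ _ (fun w => y w + delta *: v w)
  D (lag fm1 f t i) L) => // [|w]; last exact: perturbed_mem.
by apply: coord_measurableD => //; exact: coord_measurableZ.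
Qed.

(** Stated for an arbitrary measurable space, so that it applies both to the whole
    probability space and to the past: a step only reads directions that have
    been drawn already. *)
Lemma run_measurable t : (t <= T.+1)%N ->
  (forall r j, (r <= t)%N -> coord_measurable (lag um1 u r j)) ->
  (forall i, coord_measurable (x t i)) /\ (forall i, coord_measurable (xl t i)).
Proof.
elim: t => [_ _|t IH tT mlag].
  split=> i; last exact: coord_measurable_cst.
  have -> : x 0 i = (fun=> x0 i) by apply/funext => w; case: run => ->.
  exact: coord_measurable_cst.
have [|mx mxl] := IH (ltnW tT); first by move=> r j rt; apply: mlag; exact: leqW.
split=> [i|i]; last exact: mx.
have -> : x t.+1 i = (fun w => eproj X
    (\sum_(j < N) a i j *: (x t j w - eta *: estimate um1 u x t j w))).
  by apply/funext => w; case: run => _ ->.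
apply: (coord_measurable_eproj X_closed X_convex X_bounded X0).
apply: coord_measurable_sum => j; apply: coord_measurableZ => //.
under eq_fun do rewrite -scaleNr.
apply: coord_measurableD => //; apply: coord_measurableZ => //.
have mu : coord_measurable (u t j) by exact: (mlag t.+1 j (leqnn _)).
apply: coord_measurableZ => //; apply: measurable_funM => //.
apply: measurable_funB.
  apply: (proj1 (@perturbed_measurable t.+1 j _ _ (mx j) mu _ _)) => w.
    exact: (run_mem run j w (ltnW tT)).
  by rewrite (u_sphere t.+1).
apply: (proj1 (@perturbed_measurable t j _ _ (mxl j) (mlag t j (leqnSn _)) _ _)) => w.
  exact: (lag_run_mem run j w (ltnW tT)).
by rewrite u_sphere.
Qed.

Lemma bounded_measurable_perturbed_run t i (t' : nat) (v : M -> 'rV[R]_d) :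
  (t' <= T.+1)%N ->
  (forall r j, (r <= t')%N -> coord_measurable (lag um1 u r j)) ->
  coord_measurable v -> (forall w, enorm (v w) <= 1) ->
  bounded_measurable (fun w => lag fm1 f t i (x t' i w + delta *: v w)) /\
  bounded_measurable (fun w => lag fm1 f t i (xl t' i w + delta *: v w)).
Proof.
move=> tT mlag mv v1; have [mx mxl] := run_measurable tT mlag.
split; apply: perturbed_measurable => // w.
  exact: (run_mem run i w tT).
exact: (lag_run_mem run i w tT).
Qed.

Lemma bounded_measurable_value t i : (t <= T.+1)%N ->
  (forall r j, (r <= t)%N -> coord_measurable (lag um1 u r j)) ->
  bounded_measurable (fun w => f t i (x t i w)).
Proof.
move=> tT mlag.
have := proj1 (@bounded_measurable_perturbed_run t.+1 i t (fun=> 0) tT mlag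
  (coord_measurable_cst 0) _).
have -> : (fun w => lag fm1 f t.+1 i (x t i w + delta *: 0)) =
    (fun w => f t i (x t i w)) by apply/funext => w; rewrite scaler0 addr0.
by apply => w; rewrite enorm_leP// dot0l expr1n.
Qed.

End Measurability.

Section Expectation.
Context {disp : measure_display} {Om : measurableType disp}.
Variables (P : probability Om R) (um1 : 'I_N -> Om -> borel_rV R d)
  (u : nat -> 'I_N -> Om -> borel_rV R d).
Let U (k : nat * 'I_N) := lag um1 u k.1 k.2.
Hypotheses (mU : forall k, measurable_fun [set: Om] (U k))
  (u_sphere : forall t i w, enorm (lag um1 u t i w : 'rV[R]_d) = 1)
  (U_inv : forall k (Q : 'M[R]_d), Q *m Q^T = 1%:M ->
     forall B : set (borel_rV R d), measurable B ->
       P (U k @^-1` [set v | B ((v : 'rV[R]_d) *m Q)]) = P (U k @^-1` B))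
  (U_indep : forall (s : seq (nat * 'I_N)) (B : nat * 'I_N -> set (borel_rV R d)),
     uniq s -> (forall k, measurable (B k)) ->
     P (\big[setI/setT]_(k <- s) (U k @^-1` B k)) =
     (\prod_(k <- s) P (U k @^-1` B k))%E)
  (f_convex : forall t i,
     convex_function
       ([set: 'rV[R]_d] : set (convex_lmodType 'rV[R]_d)) (lag fm1 f t i)).
Variable x : nat -> 'I_N -> Om -> 'rV[R]_d.
Hypothesis run : orf_run a X eta delta fm1 f xm1 x0
  (um1 : 'I_N -> Om -> 'rV[R]_d) (u : nat -> 'I_N -> Om -> 'rV[R]_d) T x.
Variable xs : 'rV[R]_d.
Hypothesis Xxs : X xs.

Let est := estimate (um1 : 'I_N -> Om -> 'rV[R]_d) u x.

Let mlag r j : coord_measurable (lag um1 u r j : Om -> 'rV[R]_d).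
Proof. exact: (coord_measurable_of_borel (mU (r, j))). Qed.

Let bm_value t i : (t <= T)%N ->
  bounded_measurable (fun w => f t i (x t i w) - f t i xs).
Proof.
move=> tT; apply: bounded_measurableB; last exact: bounded_measurable_cst.
exact: (bounded_measurable_value (um1 := um1) (u := u) u_sphere run i (leqW tT)
  (fun r j _ => @mlag r j)).
Qed.

Let bm_dot {disp'} {M : measurableType disp'} (v y : M -> 'rV[R]_d) :
  coord_measurable v -> coord_measurable y -> (forall w, enorm (v w) <= 1) ->
  (forall w, X (y w)) -> bounded_measurable (fun w => dot (v w) (y w - xs)).
Proof.
move=> mv my v1 Xy; split.
  by apply: measurable_dot => //; apply: coord_measurableD.
exists (ru + ru) => w; apply: le_trans (normr_dot_le _ _) _.
rewrite -[leRHS]mul1r; apply: ler_pM => //; try exact: enorm_ge0.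
apply: le_trans (ler_enormD _ _) _; rewrite enormN.
by apply: lerD; exact: X_bounded.
Qed.

Let bm_est t i : (t <= T)%N ->
  bounded_measurable (fun w => dot (est t i w) (x t i w - xs)).
Proof.
move=> tT; under eq_fun do rewrite /est /estimate dotZl.
have ml r j : (r <= t)%N -> coord_measurable (lag um1 u r j : Om -> 'rV[R]_d).
  by move=> _; exact: mlag.
have le1 r j w : enorm (lag um1 u r j w : 'rV[R]_d) <= 1 by rewrite u_sphere.
apply: bounded_measurableM; first apply: bounded_measurableM.
- exact: bounded_measurable_cst.
- apply: bounded_measurableB.
    exact: (proj1 (bounded_measurable_perturbed_run u_sphere run t.+1 i (leqW tT) ml
      (@mlag t.+1 i) (le1 t.+1 i))).
  exact: (proj2 (bounded_measurable_perturbed_run u_sphere run t i (leqW tT) ml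
      (@mlag t i) (le1 t i))).
- apply: bm_dot.
  + exact: (@mlag t.+1 i).
  + exact: (run_measurable u_sphere run (leqW tT) ml).1.
  + exact: (le1 t.+1 i).
  + by move=> w; exact: (run_mem run i w (leqW tT)).
Qed.

(** Given the past, the state at time [t] is frozen, and the direction drawn at
    time [t] is still uniform: the spherical estimate applies. The residual
    value subtracted by the estimator belongs to the past, hence does not
    contribute. *)
Lemma expected_gap_le t i : (t <= T)%N ->
  \int[P]_w (f t i (x t i w) - f t i xs) - 2 * delta * L
  <= \int[P]_w dot (est t i w) (x t i w - xs).
Proof.
move=> tT; pose s := [seq (r, j) | r <- iota 0 t.+1, j <- enum 'I_N].
have in_s r j : (r <= t)%N -> (r, j) \in s.
  move=> rt; apply: allpairs_f; last by rewrite mem_enum.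
  by rewrite mem_iota.
have s_uniq : uniq ((t.+1, i) :: s).
  rewrite cons_uniq; apply/andP; split.
    apply/negP => /allpairsP[[r j] [+ _ [tr _]]].
    by rewrite mem_iota /= add0n -tr ltnn.
  by apply: allpairs_uniq; [exact: iota_uniq|exact: enum_uniq|move=> [? ?] [? ?]].
pose H := history U s.
pose um1H : 'I_N -> H -> 'rV[R]_d := um1; pose uH : nat -> 'I_N -> H -> 'rV[R]_d := u.
pose xH : nat -> 'I_N -> H -> 'rV[R]_d := x.
have runH : orf_run a X eta delta fm1 f xm1 x0 um1H uH T xH by exact: run.
have sphH r j w : enorm (lag um1H uH r j w) = 1 by exact: u_sphere.
have mlH r j : (r <= t)%N -> coord_measurable (lag um1H uH r j).
  move=> rt; apply: (@coord_measurable_of_borel _ _ _ H (U (r, j))).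
  exact: (history_measurable (in_s r j rt)).
have le1H r j w : enorm (lag um1H uH r j w) <= 1 by rewrite sphH.
pose xlH := lag (fun i (_ : H) => xm1 i) xH.
pose past (w : H) := lag fm1 f t i (xlH t i w + delta *: lag um1H uH t i w).
have bpast : bounded_measurable past.
  exact: (proj2 (bounded_measurable_perturbed_run sphH runH t i (leqW tT) mlH
      (mlH t i (leqnn t)) (le1H t i))).
have mxH : coord_measurable (xH t i).
  exact: (run_measurable sphH runH (leqW tT) mlH).1.
have XxH w : X (xH t i w) by exact: (run_mem runH i w (leqW tT)).
pose h (w : H) := f t i (xH t i w) - f t i xs - 2 * delta * L.
have bh : bounded_measurable h.
  apply: bounded_measurableB; last exact: bounded_measurable_cst.
  apply: bounded_measurableB; last exact: bounded_measurable_cst.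
  exact: (bounded_measurable_value sphH runH i (leqW tT) mlH).
pose Phi (z : H * borel_rV R d) :=
  d%:R / delta * (f t i (xH t i z.1 + delta *: clamp z.2) - past z.1) *
  dot (clamp z.2) (xH t i z.1 - xs).
have bPhi : bounded_measurable Phi.
  have m1 : coord_measurable (fun z : H * borel_rV R d => xH t i z.1).
    exact: coord_measurable_comp mxH measurable_fst.
  have m2 : coord_measurable (fun z : H * borel_rV R d => clamp z.2).
    exact: coord_measurable_comp coord_measurable_clamp measurable_snd.
  apply: bounded_measurableM; first apply: bounded_measurableM.
  - exact: bounded_measurable_cst.
  - apply: bounded_measurableB; last first.
      case: bpast => mp [K pK]; split; last by exists K => z; exact: pK.
      exact: measurableT_comp mp measurable_fst.
    split; last first.
      exists (`|f t i 0| + L * (ru + delta)) => z.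
      by apply: (@value_le t.+1); apply: perturbed_mem => //; exact: clamp_ball.
    apply: (@measurable_comp_lipschitz _ _ _ _
      (fun z : H * borel_rV R d => xH t i z.1 + delta *: clamp z.2) D (f t i) L).
    + by apply: coord_measurableD => //; exact: coord_measurableZ.
    + by move=> z; apply: perturbed_mem => //; exact: clamp_ball.
    + exact: (@f_lip t.+1 i).
  - by apply: bm_dot => // z; exact: clamp_ball.
have u1 w : enorm (U (t.+1, i) w : 'rV[R]_d) = 1 by exact: (u_sphere t.+1).
have := @freeze_history _ _ _ _ _ P _ U mU U_indep s (t.+1, i) s_uniq h Phi bh bPhi.
move=> hfreeze; rewrite -(Rintegral_prob_cst P (2 * delta * L)).
rewrite -Rintegral_sub; [|exact: bm_value|exact: bounded_measurable_cst].
have -> : (fun w => dot (est t i w) (x t i w - xs)) =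
    (fun w => Phi ((w : H), U (t.+1, i) w)).
  by apply/funext => w; rewrite /Phi /= clamp_sphere// /est /estimate dotZl.
apply: hfreeze => w.
have := @estimator_subgradient _ _ d_gt0 _ _ P (U (t.+1, i)) (mU _) u1
  (@U_inv (t.+1, i)) X (f t i) L delta (ltW L_gt0) delta_gt0
  (@f_convex t.+1 i) (@f_lip t.+1 i) (xH t i w) xs (past w) (XxH w) Xxs.
move=> /le_trans; apply; rewrite le_eqVlt; apply/orP; left; apply/eqP.
by apply: eq_Rintegral => w' _; rewrite /Phi /= clamp_sphere.
Qed.

Lemma bounded_measurable_regret : bounded_measurable
  (fun w => \sum_(1 <= t < T.+1) \sum_(i < N) (f t i (x t i w) - f t i xs)).
Proof.
have -> : (fun w => \sum_(1 <= t < T.+1) \sum_(i < N) (f t i (x t i w) - f t i xs))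
  = (fun w => \sum_(t < T) \sum_(i < N) (f t.+1 i (x t.+1 i w) - f t.+1 i xs)).
  by apply/funext => w; rewrite big_add1 big_mkord.
apply: bounded_measurable_sum => t; apply: bounded_measurable_sum => i.
exact: bm_value.
Qed.

Hypotheses (delta_le2 : delta <= 2)
  (rho_small : (eta * d%:R / delta) ^+ 2 * (6 * L ^+ 2 / c + 6 * L ^+ 2) <= 1 / 4).

Lemma expected_regret_bound :
  \int[P]_w (\sum_(1 <= t < T.+1) \sum_(i < N) (f t i (x t i w) - f t i xs))
  <= T%:R * (N%:R * (2 * delta * L)) +
     (N%:R * (4 * ru ^+ 2) + (eta * d%:R / delta) ^+ 2 *
       energy_bound (acc_increasing_rate X delta f T)) / (2 * eta).
Proof.
under eq_Rintegral do rewrite big_add1 big_mkord.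
rewrite Rintegral_bigsum; last first.
  by move=> t; apply: bounded_measurable_sum => i; exact: bm_value.
have h1 : \sum_(t < T) \int[P]_w (\sum_(i < N) (f t.+1 i (x t.+1 i w) - f t.+1 i xs))
    <= T%:R * (N%:R * (2 * delta * L)) +
       \sum_(t < T) \int[P]_w (\sum_(i < N) dot (est t.+1 i w) (x t.+1 i w - xs)).
  have -> : T%:R * (N%:R * (2 * delta * L)) =
      \sum_(t < T) \sum_(i < N) (2 * delta * L).
    by rewrite !sumr_const !card_ord !mulr_natl.
  rewrite -big_split /=; apply: ler_sum => t _.
  rewrite !Rintegral_bigsum => [|i|i]; [|exact: bm_est|exact: bm_value].
  rewrite -big_split /=; apply: ler_sum => i _.
  by rewrite -lerBlDl; exact: expected_gap_le.
apply: le_trans h1 _; rewrite lerD2l -Rintegral_bigsum; last first.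
  by move=> t; apply: bounded_measurable_sum => i; exact: bm_est.
rewrite -[leRHS](Rintegral_prob_cst P); apply: Rintegral_le.
- apply: bounded_measurable_sum => t; apply: bounded_measurable_sum => i.
  exact: bm_est.
- exact: bounded_measurable_cst.
move=> w; have := linearized_regret_bound u_sphere run delta_le2 rho_small w Xxs.
by rewrite big_add1 big_mkord.
Qed.

End Expectation.
End Run.

(** * Reduction to directions that lie on the sphere everywhere *)

Section FullMeasure.
Import HBNNSimple.

(** A simple function below [f] can be cut off outside [G], which preserves its
    integral and puts it below [g]; hence no measurability is involved. *)
Lemma integral_eq_full_measure (R : realType) (disp : measure_display)
    (M : measurableType disp) (mu : {measure set M -> \bar R}) (G : set M)
    (f g : M -> \bar R) :
  measurable G -> mu (~` G) = 0%E -> (forall w, G w -> f w = g w) ->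
  (\int[mu]_w f w = \int[mu]_w g w)%E.
Proof.
move=> mG G0.
have le (f1 f2 : M -> \bar R) : (forall w, 0 <= f1 w)%E ->
    (forall w, 0 <= f2 w)%E -> (forall w, G w -> f1 w = f2 w) ->
    (\int[mu]_w f1 w <= \int[mu]_w f2 w)%E.
  move=> f10 f20 f12; rewrite (ge0_integralTE _ f10) (ge0_integralTE _ f20).
  apply: ge_ereal_sup => _ [h /= hf1 <-].
  apply: ereal_sup_ubound; exists (proj_nnsfun h mG).
    move=> w; rewrite -mrestrict /patch; case: ifPn => [|_]; last exact: f20.
    by rewrite inE => Gw; rewrite -f12.
  rewrite -[in LHS]integralT_nnsfun -[in RHS]integralT_nnsfun.
  have e : (\int[mu]_w (h w)%:E = \int[mu]_(w in G) (h w)%:E)%E.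
    rewrite (ge0_negligible_integral (measurableC mG) measurableT _ _ G0).
    - by rewrite setTD setCK.
    - exact/measurable_EFinP.
    - by move=> w _; rewrite lee_fin.
  rewrite e [RHS]integral_mkcond; apply: eq_integral => w _.
  by rewrite -mrestrict /= /patch; case: ifP.
move=> fg; rewrite [LHS]integralE [RHS]integralE; congr (_ - _)%E.
  by apply/eqP; rewrite eq_le !le// => w Gw; rewrite !unlock fg.
by apply/eqP; rewrite eq_le !le// => w Gw; rewrite !unlock fg.
Qed.

End FullMeasure.

(** Collapsing a null set to one point preserves the law of every variable and
    lets properties that hold almost surely hold everywhere. *)
Section Retraction.
Context {R : realType} {disp : measure_display} {Om : measurableType disp}.
Variables (P : probability Om R) (G : set Om) (w0 : Om).
Hypotheses (mG : measurable G) (G0 : P (~` G) = 0%E) (Gw0 : G w0).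

Definition retract (w : Om) : Om := if w \in G then w else w0.

Lemma retract_mem w : G (retract w).
Proof. by rewrite /retract; case: ifPn => [/set_mem|]. Qed.

Lemma retract_id w : G w -> retract w = w.
Proof. by move=> Gw; rewrite /retract mem_set. Qed.

Lemma retract_measurable : measurable_fun [set: Om] retract.
Proof.
move=> _ A mA; rewrite setTI.
have -> : retract @^-1` A =
    (A `&` G) `|` (if w0 \in A then ~` G else set0).
  apply/seteqP; split => w /=; rewrite /retract.
    case: ifPn => [/set_mem Gw Aw|/negP Gw Aw0]; first by left.
    by right; rewrite mem_set// => /mem_set.
  case=> [[Aw Gw]|]; first by rewrite mem_set.
  by case: ifPn => // /set_mem Aw0 Gw; case: ifPn => // /set_mem.
apply: measurableU; first exact: measurableI.
by case: ifP => _; [exact: measurableC | exact: measurable0].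
Qed.

Lemma retract_preserves (A : set Om) :
  measurable A -> P (retract @^-1` A) = P A.
Proof.
have restrictE (B : set Om) : measurable B -> P B = P (B `&` G).
  move=> mB; have e : P (B `\` G) = 0%E.
    apply: (@subset_measure0 _ _ _ P _ (~` G)) => //; first exact: measurableD.
    exact: measurableC.
  apply: etrans (measureDI P mB mG) _.
  apply: etrans (congr1 (fun r => r + P (B `&` G))%E e) _; exact: add0e.
move=> mA.
have mRA : measurable (retract @^-1` A).
  by rewrite -[X in measurable X]setTI; exact: retract_measurable.
rewrite (restrictE _ mRA) (restrictE _ mA); congr (P _).
by apply/seteqP; split => w /= [+ Gw]; rewrite retract_id.
Qed.

End Retraction.

(** Countably many events of probability one. *)
Lemma almost_surely_on_sphere (R : realType) (d : nat) (disp : measure_display)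
    (Om : measurableType disp) (P : probability Om R) (I : countType)
    (U : I -> Om -> borel_rV R d) :
  (forall k, measurable_fun [set: Om] (U k)) ->
  (forall k, P (U k @^-1` (@esphere R d : set (borel_rV R d))) = 1%E) ->
  exists G : set Om, [/\ measurable G, P (~` G) = 0%E &
    forall w k, G w -> enorm (U k w : 'rV[R]_d) = 1].
Proof.
move=> mU U1.
have msph : measurable (@esphere R d : set (borel_rV R d)).
  have -> : (@esphere R d : set (borel_rV R d)) =
      setT `&` (fun v : borel_rV R d => dot (v : 'rV[R]_d) v) @^-1` [set 1].
    rewrite setTI; apply/seteqP; split => v /= v1; first exact: enorm_eq1.
    by rewrite /esphere /= /enorm -[RHS]sqrtr1 -v1.
  apply: (measurable_dot (coord_measurable_borel) (coord_measurable_borel)) => //.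
have mE k : measurable (U k @^-1` (@esphere R d : set (borel_rV R d))).
  by rewrite -[X in measurable X]setTI; exact: (mU k measurableT _ msph).
have : P.-negligible (\bigcup_n (if unpickle n is Some k
    then ~` (U k @^-1` (@esphere R d : set (borel_rV R d))) else set0)).
  apply: negligible_bigcup => n; case: (unpickle n) => [k|]; last exact: negligible_set0.
  apply/negligibleP; first exact: measurableC.
  apply: etrans (probability_setC P (mE k)) _.
  apply: etrans (congr1 (fun r => 1 - r)%E (U1 k)) _; exact: subee.
move=> [A [mA A0 sA]]; exists (~` A); split; first exact: measurableC.
  by rewrite setCK.
move=> w k nAw; apply: contrapT => nk; apply: nAw; apply: sA.
by exists (pickle k) => //; rewrite pickleK.
Qed.

(** * The regret bound *)

Section Constants.
Context {R : realType}.

Lemma alphac_gt0 (N : nat) (eps : R) : (0 < N)%N -> 0 < eps < 1 ->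
  0 < alphac N eps.
Proof.
move=> N0 /andP[e0 e1]; rewrite /alphac.
have N1 : 1 <= N%:R :> R by rewrite ler1n.
have NN : 1 <= N%:R ^+ 2 :> R by rewrite exprn_ege1.
have p4 : 0 < 4 * N%:R ^+ 2 :> R by lra.
have g0 : 0 < gammac N eps.
  by rewrite /gammac subr_gt0 ltr_pdivrMr// mul1r; lra.
have g1 : gammac N eps < 1 by rewrite /gammac ltrBlDr ltrDl divr_gt0.
rewrite ltr_wpDr// divr_ge0 ?mulr_ge0 ?sqr_ge0// subr_ge0.
by rewrite -(expr1n R 2) ler_pXn2r ?nnegrE ?ltW.
Qed.

Lemma powR_third (T : nat) :
  (T%:R `^ (1 / 3) : R) ^+ 3 = T%:R /\
  T%:R `^ (2 / 3) = (T%:R `^ (1 / 3) : R) ^+ 2.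
Proof.
rewrite -!powR_mulrn ?powR_ge0// -!powRrM; split.
  by rewrite divfK ?pnatr_eq0// powRr1.
by congr (_ `^ _); field.
Qed.

(** With [q] the cube root of [T], every contribution to the bound is at most a
    constant times [q ^ 2] or [Theta ^ 2]. *)
Lemma regret_rate (N d T : nat) (q B L c ru E0 Theta delta eta : R) :
  1 <= q -> T%:R = q ^+ 3 -> 0 < B -> 0 < L -> 0 < c -> 0 <= E0 ->
  delta = 2 / q -> eta = (B * q ^+ 2)^-1 ->
  T%:R * (N%:R * (2 * delta * L)) +
  (N%:R * (4 * ru ^+ 2) + (eta * d%:R / delta) ^+ 2 *
    (2 * (E0 + 3 * Theta ^+ 2 + 12 * L ^+ 2 * delta ^+ 2 * (T%:R * N%:R)
       + 6 * L ^+ 2 / c * (N%:R * ru ^+ 2)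
       + 144 * L ^+ 4 / c ^+ 2 * ru ^+ 2 * (eta * d%:R / delta) ^+ 2
           * (T.+1%:R * N%:R)))) / (2 * eta)
  <= (4 * N%:R * L + 2 * N%:R * ru ^+ 2 * B + d%:R ^+ 2 / (4 * B) *
      (E0 + 3 + 48 * L ^+ 2 * N%:R + 6 * L ^+ 2 / c * (N%:R * ru ^+ 2)
       + 72 * L ^+ 4 / c ^+ 2 * ru ^+ 2 * (d%:R ^+ 2 / B ^+ 2) * N%:R))
     * Num.max (q ^+ 2) (Theta ^+ 2).
Proof.
move=> q1 Tq B0 L0 c0 E00 -> ->.
have q0 : 0 < q by exact: lt_le_trans ltr01 q1.
set M := Num.max _ _.
have qM : q ^+ 2 <= M by rewrite le_max lexx.
have tM : Theta ^+ 2 <= M by rewrite le_max lexx orbT.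
have q2 : q <= q ^+ 2 by rewrite expr2 ler_peMr// ltW.
have q1M : q <= M by exact: le_trans q2 qM.
have M1 : 1 <= M by exact: le_trans q1 q1M.
have n0 : 0 <= N%:R :> R by [].
have rhoE : (B * q ^+ 2)^-1 * d%:R / (2 / q) = d%:R / (2 * B * q).
  by field; rewrite !gt_eqF.
rewrite rhoE.
have e1 : T%:R * (N%:R * (2 * (2 / q) * L)) = 4 * N%:R * L * q ^+ 2.
  by rewrite Tq; field; rewrite gt_eqF.
set E := 2 * (_ + _).
have E_le : E <= 2 * (E0 + 3 + 48 * L ^+ 2 * N%:R + 6 * L ^+ 2 / c * (N%:R * ru ^+ 2)
       + 72 * L ^+ 4 / c ^+ 2 * ru ^+ 2 * (d%:R ^+ 2 / B ^+ 2) * N%:R) * M.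
  rewrite /E -[leRHS]mulrA ler_pM2l// !(mulrDl _ _ M).
  apply: lerD; last first; [|apply: lerD; [apply: lerD; [apply: lerD|]|]].
  - set K := 144 * L ^+ 4 / c ^+ 2 * ru ^+ 2.
    have K0 : 0 <= K.
      by rewrite /K mulr_ge0 ?sqr_ge0// divr_ge0 ?sqr_ge0// mulr_ge0// exprn_ge0// ltW.
    have T1 : T.+1%:R <= 2 * q ^+ 3 :> R.
      by rewrite -addn1 natrD Tq mulr_natl mulr2n lerD2l exprn_ege1.
    have -> : 72 * L ^+ 4 / c ^+ 2 * ru ^+ 2 * (d%:R ^+ 2 / B ^+ 2) * N%:R * M =
        K * (d%:R / (2 * B)) ^+ 2 * (2 * N%:R * M).
      by rewrite /K; field; rewrite !gt_eqF.
    have -> : K * (d%:R / (2 * B * q)) ^+ 2 * (T.+1%:R * N%:R) =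
        K * (d%:R / (2 * B)) ^+ 2 * (T.+1%:R * N%:R / q ^+ 2).
      by field; rewrite !gt_eqF.
    apply: ler_wpM2l; first by rewrite mulr_ge0 ?sqr_ge0.
    rewrite ler_pdivrMr ?exprn_gt0//.
    apply: le_trans (ler_wpM2r n0 T1) _.
    have -> : 2 * q ^+ 3 * N%:R = 2 * N%:R * q * q ^+ 2 by ring.
    by rewrite ler_pM2r ?exprn_gt0// ler_wpM2l// mulr_ge0.
  - by rewrite ler_peMr.
  - by move: tM; lra.
  - have -> : 12 * L ^+ 2 * (2 / q) ^+ 2 * (T%:R * N%:R) = 48 * L ^+ 2 * N%:R * q.
      by rewrite Tq; field; rewrite gt_eqF.
    by apply: ler_wpM2l => //; rewrite mulr_ge0// mulr_ge0// sqr_ge0.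
  - rewrite ler_peMr// mulr_ge0//; last by rewrite mulr_ge0 ?sqr_ge0.
    by rewrite divr_ge0 ?(ltW c0)// mulr_ge0 ?sqr_ge0.
set F := E0 + 3 + _ + _ + _ in E_le *.
have -> : (N%:R * (4 * ru ^+ 2) + (d%:R / (2 * B * q)) ^+ 2 * E) /
    (2 * (B * q ^+ 2)^-1) =
    2 * N%:R * ru ^+ 2 * B * q ^+ 2 + d%:R ^+ 2 / (8 * B) * E.
  by field; rewrite !gt_eqF.
rewrite e1 !(mulrDl _ _ M) -[leRHS]addrA; apply: lerD; last apply: lerD.
- by apply: ler_wpM2l => //; rewrite mulr_ge0 ?(ltW L0)// mulr_ge0.
- by apply: ler_wpM2l => //; rewrite mulr_ge0 ?(ltW B0)// mulr_ge0 ?sqr_ge0.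
have -> : d%:R ^+ 2 / (4 * B) * F * M = d%:R ^+ 2 / (8 * B) * (2 * F * M).
  by field; rewrite gt_eqF.
by apply: ler_wpM2l => //; rewrite divr_ge0 ?sqr_ge0// mulr_ge0// ltW.
Qed.

End Constants.

Theorem theorem1 (R : realType) (N d : nat) (hN : (0 < N)%N) (hd : (0 < d)%N)
  (E : rel 'I_N) (a : 'M[R]_N) (eps : R)
  (E_sym : symmetric E)
  (a_edge : forall i j, E i j -> 0 < a i j)
  (a_diag : forall i, 0 < a i i)
  (a_nonedge : forall i j, i != j -> ~~ E i j -> a i j = 0)
  (eps01 : 0 < eps < 1)
  (a_eps : forall i j, E j i -> eps < a i j)
  (a_col : forall j, \sum_(i < N) a i j = 1)
  (a_row : forall i, \sum_(j < N) a i j = 1)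
  (X : set 'rV[R]_d)
  (X_closed : closed X)
  (X_convex : convex_set (X : set (convex_lmodType 'rV[R]_d)))
  (rl ru : R) (rl_gt0 : 0 < rl) (ru_gt0 : 0 < ru)
  (X_lower : [set rl *: v | v in @eball R d] `<=` X)
  (X_upper : X `<=` [set ru *: v | v in @eball R d])
  (fm1 : 'I_N -> 'rV[R]_d -> R) (f : nat -> 'I_N -> 'rV[R]_d -> R)
  (f_convex : forall t i,
     convex_function
       ([set: 'rV[R]_d] : set (convex_lmodType 'rV[R]_d)) (lag fm1 f t i))
  (L0 : R) (L0_gt0 : 0 < L0)
  (xm1 x0 : 'I_N -> 'rV[R]_d)
  (xm1_X : forall i, X (xm1 i)) (x0_X : forall i, X (x0 i))
  (disp : measure_display) (Om : measurableType disp) (P : probability Om R)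
  (um1 : 'I_N -> {RV P >-> borel_rV R d})
  (u : nat -> 'I_N -> {RV P >-> borel_rV R d})
  (u_unif : forall t i, uniform_on_sphere (distribution P (lag um1 u t i)))
  (u_indep : mutually_independent
     (fun k : nat * 'I_N => lag um1 u k.1 k.2)) :
  exists2 C : R, 0 < C &
  \forall T \near \oo,
    let eta := etac N d eps L0 T in
    let delta : R := deltac R T in
    let Theta := acc_increasing_rate X delta f T in
    (forall t i,
       lipschitz_in L0 (dilate X delta (@eball R d)) (lag fm1 f t i)) ->
    forall x : nat -> 'I_N -> Om -> 'rV[R]_d,
    orf_run a X eta delta fm1 f xm1 x0
      (fun i w => um1 i w) (fun t i w => u t i w) T x ->
    forall xs : 'rV[R]_d,
    is_argmin X (fun y => \sum_(1 <= t < T.+1) \sum_(i < N) f t i y) xs ->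
    (regret P f x xs T
       <= (C * Num.max (T%:R `^ (2 / 3)) (Theta ^+ 2))%:E)%E.
Proof.
have a_ge0 i j : 0 <= a i j.
  have [->|ij] := eqVneq i j; first exact: ltW.
  by case Eij : (E i j); [exact: ltW (a_edge _ _ Eij)|rewrite a_nonedge ?Eij].
(* A positive lower bound of all self-weights. *)
pose c := (\sum_(i < N) (a i i)^-1)^-1.
have inv_le i : (a i i)^-1 <= \sum_(j < N) (a j j)^-1.
  rewrite (bigD1 i)//= lerDl; apply: sumr_ge0 => j _.
  by rewrite invr_ge0.
have sum_gt0 : 0 < \sum_(j < N) (a j j)^-1.
  by apply: lt_le_trans (inv_le (Ordinal hN)); rewrite invr_gt0.
have c_gt0 : 0 < c by rewrite invr_gt0.
have c_le i : c <= a i i.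
  by rewrite -[leRHS]invrK lef_pV2 ?posrE ?invr_gt0.
have X0 : X 0.
  apply: X_lower; exists 0; last by rewrite scaler0.
  by rewrite /eball /= enorm_leP// dot0l expr1n.
have X_bounded z : X z -> enorm z <= ru.
  move=> /X_upper[v v1 <-]; rewrite enormZ gtr0_norm//.
  by rewrite ler_piMr// ltW.
have ru_ge0 := ltW ru_gt0.
pose U (k : nat * 'I_N) : Om -> borel_rV R d := lag um1 u k.1 k.2.
have mU k : measurable_fun [set: Om] (U k).
  by rewrite /U; case: k => [[|r] j] /=; exact: measurable_funPT.
have [G [mG G0 GU]] := almost_surely_on_sphere mU
  (fun k => (u_unif k.1 k.2).1).
have [w0 Gw0] : exists w, G w.
  apply: contrapT => nG; have PG : P (~` G) = 1%E.
    rewrite (_ : ~` G = setT); first exact: probability_setT.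
    by apply/seteqP; split => // w _ Gw; apply: nG; exists w.
  by move: PG; rewrite G0 => /eqP; rewrite eq_sym onee_eq0.
pose pi := retract G w0.
have mpi : measurable_fun [set: Om] pi := retract_measurable w0 mG.
(* The run driven by the retracted directions is the retraction of the run. *)
pose um1' i : Om -> borel_rV R d := fun w => um1 i (pi w).
pose u' t i : Om -> borel_rV R d := fun w => u t i (pi w).
have lagE t i w : lag um1' u' t i w = U (t, i) (pi w) by case: t.
have mU' k : measurable_fun [set: Om] (lag um1' u' k.1 k.2).
  have -> : lag um1' u' k.1 k.2 = U k \o pi.
    by apply/funext => w; rewrite lagE; case: k.
  exact: measurableT_comp (mU k) mpi.
have u'_sphere t i w : enorm (lag um1' u' t i w : 'rV[R]_d) = 1.
  by rewrite lagE; apply: GU; exact: retract_mem.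
have pre_pi k (B : set (borel_rV R d)) :
    lag um1' u' k.1 k.2 @^-1` B = pi @^-1` (U k @^-1` B).
  by apply/seteqP; split => w /=; rewrite lagE; case: k.
have mpre k (B : set (borel_rV R d)) : measurable B -> measurable (U k @^-1` B).
  by move=> mB; rewrite -[X in measurable X]setTI; exact: (mU k measurableT _ mB).
have PU' k (B : set (borel_rV R d)) : measurable B ->
    P (lag um1' u' k.1 k.2 @^-1` B) = P (U k @^-1` B).
  by move=> mB; rewrite pre_pi; apply: retract_preserves => //; exact: mpre.
have U'_inv k (Q : 'M[R]_d) : Q *m Q^T = 1%:M ->
    forall B : set (borel_rV R d), measurable B ->
    P (lag um1' u' k.1 k.2 @^-1` [set v | B ((v : 'rV[R]_d) *m Q)]) =
    P (lag um1' u' k.1 k.2 @^-1` B).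
  move=> QQ B mB.
  have mBQ : measurable ([set v | B ((v : 'rV[R]_d) *m Q)] : set (borel_rV R d)).
    have mQ : measurable_fun [set: borel_rV R d]
        (fun v : borel_rV R d => ((v : 'rV[R]_d) *m Q) : borel_rV R d).
      apply: measurable_rV => k'.
      rewrite (_ : (fun _ => _) = (fun v : borel_rV R d =>
        \sum_(j < d) (v : 'rV[R]_d) 0 j * Q j k')).
        apply: measurable_sum => j; apply: measurable_funM => //.
        exact: coord_measurable_borel.
      by apply/funext => v; rewrite mxE.
    by rewrite -[X in measurable X]setTI; exact: (mQ measurableT _ mB).
  rewrite PU'// PU'//; exact: ((u_unif k.1 k.2).2 Q QQ B mB).
have U'_indep (s : seq (nat * 'I_N)) (B : nat * 'I_N -> set (borel_rV R d)) :
    uniq s -> (forall k, measurable (B k)) ->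
    P (\big[setI/setT]_(k <- s) (lag um1' u' k.1 k.2 @^-1` B k)) =
    (\prod_(k <- s) P (lag um1' u' k.1 k.2 @^-1` B k))%E.
  move=> us mB.
  transitivity (P (\big[setI/setT]_(k <- s) (U k @^-1` B k))).
    have -> : \big[setI/setT]_(k <- s) (lag um1' u' k.1 k.2 @^-1` B k) =
        pi @^-1` (\big[setI/setT]_(k <- s) (U k @^-1` B k)).
      rewrite -!bigcap_seq preimage_bigcap.
      by apply: eq_bigcapr => k _; rewrite pre_pi.
    apply: retract_preserves => //; apply: bigsetI_measurable => k _.
    exact: mpre.
  apply: etrans (u_indep s B us mB) _.
  by apply: eq_bigr => k _; apply/esym/PU'.
have alpha_gt0 := alphac_gt0 hN eps01.
pose B := Num.sqrt (3 * alphac N eps) * d%:R * L0.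
have B_gt0 : 0 < B by rewrite !mulr_gt0 ?sqrtr_gt0 ?mulr_gt0// ltr0n.
pose kappa := 6 * L0 ^+ 2 / c + 6 * L0 ^+ 2.
have L2_gt0 : 0 < L0 ^+ 2 by rewrite exprn_gt0.
have kappa_ge0 : 0 <= kappa.
  have L6 : 0 <= 6 * L0 ^+ 2 by rewrite mulr_ge0// ltW.
  by rewrite addr_ge0// divr_ge0// ltW.
(* [q >= K] makes [(eta * d / delta) ^+ 2 * kappa] at most [1 / 4]. *)
pose K := 1 + d%:R ^+ 2 * kappa / B ^+ 2.
have K1 : 1 <= K.
  by rewrite lerDl; apply: divr_ge0; [rewrite mulr_ge0 ?sqr_ge0|exact: sqr_ge0].
pose E0 := initial_energy ru fm1 f L0.
have E0_ge0 : 0 <= E0 by apply: sumr_ge0 => i _; exact: sqr_ge0.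
pose C := 4 * N%:R * L0 + 2 * N%:R * ru ^+ 2 * B + d%:R ^+ 2 / (4 * B) *
  (E0 + 3 + 48 * L0 ^+ 2 * N%:R + 6 * L0 ^+ 2 / c * (N%:R * ru ^+ 2)
   + 72 * L0 ^+ 4 / c ^+ 2 * ru ^+ 2 * (d%:R ^+ 2 / B ^+ 2) * N%:R).
exists (`|C| + 1); first by rewrite ltr_wpDl.
near=> T => f_lip x run xs [Xxs _].
set delta := deltac R T in f_lip run *; set eta := etac N d eps L0 T in run.
set Theta := acc_increasing_rate X delta f T.
have [Tq Tq2] := @powR_third R T.
set q : R := T%:R `^ (1 / 3) in Tq Tq2.
have qK : K <= q.
  rewrite -(@ler_pXn2r _ 3) ?nnegrE ?powR_ge0 ?(le_trans ler01 K1)// Tq.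
  by near: T; exact: nbhs_infty_ger.
have q1 : 1 <= q by exact: le_trans K1 qK.
have q_gt0 : 0 < q by exact: lt_le_trans ltr01 q1.
have deltaE : delta = 2 / q by [].
have etaE : eta = (B * q ^+ 2)^-1 by rewrite /eta /etac Tq2.
have delta_gt0 : 0 < delta by rewrite deltaE divr_gt0.
have eta_gt0 : 0 < eta by rewrite etaE invr_gt0 mulr_gt0// exprn_gt0.
have delta_le2 : delta <= 2 by rewrite deltaE ler_pdivrMr// ler_peMr.
have rho_small : (eta * d%:R / delta) ^+ 2 * (6 * L0 ^+ 2 / c + 6 * L0 ^+ 2) <= 1 / 4.
  rewrite -/kappa.
  have -> : (eta * d%:R / delta) ^+ 2 * kappa =
      (d%:R ^+ 2 * kappa / B ^+ 2) / q ^+ 2 * (1 / 4).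
    by rewrite etaE deltaE; field; rewrite !gt_eqF.
  rewrite ger_pMl// ler_pdivrMr ?exprn_gt0// mul1r.
  apply: le_trans (_ : q <= _); last by rewrite expr2 ler_peMr// ltW.
  by apply: le_trans qK; rewrite lerDr.
pose x' t i w := x t i (pi w).
have run' : orf_run a X eta delta fm1 f xm1 x0
    (um1' : 'I_N -> Om -> 'rV[R]_d) (u' : nat -> 'I_N -> Om -> 'rV[R]_d) T x'.
  case: run => run0 runS; split => [i w|t i w tT]; first exact: run0.
  by case: t tT => [|t] tT; exact: (runS _ i (pi w) tT).
have bound := expected_regret_bound hd c_gt0 a_ge0 c_le a_col a_row X_closed
  X_convex X_bounded X0 ru_ge0 L0_gt0 delta_gt0 eta_gt0 f_lip xm1_X x0_X
  mU' u'_sphere U'_inv U'_indep f_convex run' Xxs delta_le2 rho_small.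
have bm := bounded_measurable_regret X_closed X_convex X_bounded X0 L0_gt0
  delta_gt0 f_lip xm1_X x0_X mU' u'_sphere run' xs.
rewrite /regret unlock.
rewrite (integral_eq_full_measure (g := fun w => (\sum_(1 <= t < T.+1)
  \sum_(i < N) (f t i (x' t i w) - f t i xs))%:E) mG G0); last first.
  by move=> w Gw; rewrite /x' /pi retract_id.
have fin : (\int[P]_w (\sum_(1 <= t < T.+1) \sum_(i < N)
    (f t i (x' t i w) - f t i xs))%:E)%E \is a fin_num.
  exact: (integrable_fin_num _ (bounded_measurable_integrable P bm)).
rewrite -(fineK fin) lee_fin; apply: le_trans bound _.
apply: le_trans (regret_rate N d ru Theta q1 (esym Tq) B_gt0 L0_gt0 c_gt0
  E0_ge0 deltaE etaE) _.
rewrite Tq2 -/C ler_wpM2r//.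
  by rewrite le_max sqr_ge0.
by apply: le_trans (ler_norm _) _; rewrite lerDl.
Unshelve. all: by end_near.
Qed.
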